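(* Let $\mathbb{X}$ be a complex Banach space and let $x=(x(n))_{n=1}^\infty$ be a bounded sequence in $\mathbb{X}$ such that the set $\sigma(x)$ of all non-removable singular points of $g(\lambda)=R(\lambda,\bar S)\bar x$ is countable, and suppose that for each $\xi_0\in\sigma(x)$ $$\lim_{\lambda\downarrow\xi_0}(\lambda-\xi_0)R(\lambda,\bar S)\bar x=0.$$ Then $$\lim_{n\to\infty}x(n)=0.$$
   Context: Let $\mathbb{N}=\{1,2,\dots\}$, $\Gamma=\{z\in\mathbb{C}:|z|=1\}$. Let $l^\infty(\mathbb{X})$ be the Banach space of bounded sequences $(x(n))_{n\in\mathbb{N}}$ in $\mathbb{X}$ with sup-norm, and $c_0$ its closed subspace of sequences in $\mathbb{X}$ converging to $0$. The shift $S$ on $l^\infty(\mathbb{X})$ is $(Sx)(n)=x(n+1)$. Let $\mathbb{Y}=l^\infty(\mathbb{X})/c_0$ with the quotient norm; $\bar x\in\mathbb{Y}$ is the class of $x\in l^\infty(\mathbb{X})$. Since $S$ leaves $c_0$ invariant it induces an operator $\bar S$ on $\mathbb{Y}$, which is a surjective isometry, so that $\sigma(\bar S)\subset\Gamma$. For an operator $A$, $R(\lambda,A)=(\lambda-A)^{-1}$ for $\lambda$ in the resolvent set. The function $g(\lambda)=R(\lambda,\bar S)\bar x$ is $\mathbb{Y}$-valued and analytic on $\mathbb{C}\setminus\Gamma$. The spectrum $\sigma(x)$ of $x$ is the set of all non-removable singular points of $g$, i.e. the set of those $\xi\in\Gamma$ having no open neighborhood $U$ such that $g|_{U\setminus\Gamma}$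 extends to an analytic function on $U$; it is a closed subset of $\Gamma$. For $0\neq z=re^{i\varphi}$ with $r=|z|$, the directional limit is $\lim_{\lambda\downarrow z}F(\lambda):=\lim_{s\downarrow r}F(se^{i\varphi})$ (with $s>r$). ''Countable'' includes finite or empty. *)

(* Defs.v *)
From Stdlib Require Import Reals Lra Classical ClassicalEpsilon.
From Stdlib Require Import FunctionalExtensionality PropExtensionality.
From Stdlib Require Import ProofIrrelevance.
From Coquelicot Require Import Coquelicot.

Set Implicit Arguments.
Unset Strict Implicit.
Unset Printing Implicit Defensive.

Open Scope R_scope.

Lemma minus_unfold (G : AbelianGroup) (u v : G) :
  minus u v = plus u (opp v).
Proof. reflexivity. Qed.

Lemma minus_plus_plus (G : AbelianGroup) (a b u v : G) :
  minus (plus a b) (plus u v) = plus (minus a u) (minus b v).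
Proof.
  rewrite !minus_unfold, opp_plus, <- !plus_assoc. f_equal.
  rewrite !plus_assoc. f_equal. apply plus_comm.
Qed.

Lemma minus_minus_l (G : AbelianGroup) (u v : G) :
  minus (minus u v) u = opp v.
Proof.
  rewrite !minus_unfold, (plus_comm (plus u _)), (plus_assoc (opp u)).
  rewrite plus_opp_l. apply plus_zero_l.
Qed.

Lemma plus_opp_minus (G : AbelianGroup) (u v : G) :
  plus u (opp (minus u v)) = v.
Proof.
  rewrite opp_minus, minus_unfold, (plus_comm u), <- plus_assoc.
  eapply eq_trans; [apply f_equal, (plus_opp_l u)|apply plus_zero_r].
Qed.

Record is_norm (K : AbsRing) (V : ModuleSpace K) (N : V -> R) : Prop := {
  is_norm_triangle : forall u v : V, N (plus u v) <= N u + N v;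
  is_norm_scal : forall (k : K) (u : V), N (scal k u) <= abs k * N u;
  is_norm_eq_zero : forall u : V, N u = 0 -> u = zero
}.

Definition norm_ball (K : AbsRing) (V : ModuleSpace K) (N : V -> R)
  (u : V) (e : R) (v : V) : Prop := N (minus v u) < e.

Lemma is_norm_zero (K : AbsRing) (V : ModuleSpace K) (N : V -> R) :
  is_norm N -> N zero = 0.
Proof.
  intros HN.
  assert (H1 : N zero <= 0).
  { pose proof (is_norm_scal HN zero zero) as H.
    assert (E : scal (zero : K) (zero : V) = zero) by apply scal_zero_r.
    rewrite E in H. pose proof (@abs_zero K) as E0. rewrite E0 in H. lra. }
  pose proof (is_norm_triangle HN zero zero) as H2.
  rewrite plus_zero_l in H2. lra.
Qed.

Lemma is_norm_opp (K : AbsRing) (V : ModuleSpace K) (N : V -> R) (u : V) :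
  is_norm N -> N (opp u) <= N u.
Proof.
  intros HN. rewrite <- scal_opp_one.
  eapply Rle_trans; [apply (is_norm_scal HN)|].
  rewrite abs_opp_one; lra.
Qed.

Lemma norm_ball_center (K : AbsRing) (V : ModuleSpace K) (N : V -> R) :
  is_norm N -> forall (u : V) (e : posreal), norm_ball N u e u.
Proof.
  intros HN u e. unfold norm_ball. rewrite minus_eq_zero.
  eapply Rle_lt_trans; [right; exact (is_norm_zero HN)|apply cond_pos].
Qed.

Lemma norm_ball_sym (K : AbsRing) (V : ModuleSpace K) (N : V -> R) :
  is_norm N ->
  forall (u v : V) (e : R), norm_ball N u e v -> norm_ball N v e u.
Proof.
  unfold norm_ball; intros HN u v e H.
  rewrite <- opp_minus.
  eapply Rle_lt_trans; [apply (is_norm_opp _ HN)|exact H].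
Qed.

Lemma norm_ball_triangle (K : AbsRing) (V : ModuleSpace K) (N : V -> R) :
  is_norm N ->
  forall (u v w : V) (e1 e2 : R),
    norm_ball N u e1 v -> norm_ball N v e2 w -> norm_ball N u (e1 + e2) w.
Proof.
  unfold norm_ball; intros HN u v w e1 e2 H1 H2.
  rewrite (minus_trans v w u).
  eapply Rle_lt_trans; [apply (is_norm_triangle HN)|]. lra.
Qed.

Definition norm_UniformSpace_mixin (K : AbsRing) (V : ModuleSpace K)
  (N : V -> R) (HN : is_norm N) : UniformSpace.mixin_of V :=
  UniformSpace.Mixin V zero (norm_ball N) (norm_ball_center HN)
    (norm_ball_sym HN) (norm_ball_triangle HN).

Definition norm_NormedModuleAux (K : AbsRing) (V : ModuleSpace K)
  (N : V -> R) (HN : is_norm N) : NormedModuleAux K :=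
  NormedModuleAux.Pack K V
    (NormedModuleAux.Class K V (ModuleSpace.class K V)
       (norm_UniformSpace_mixin HN)) V.

Lemma norm_ball_compat2 (K : AbsRing) (V : ModuleSpace K) (N : V -> R)
  (u v : V) (e : posreal) : norm_ball N u e v -> N (minus v u) < 1 * e.
Proof. unfold norm_ball; lra. Qed.

Definition norm_NormedModule_mixin (K : AbsRing) (V : ModuleSpace K)
  (N : V -> R) (HN : is_norm N) :
  NormedModule.mixin_of K (norm_NormedModuleAux HN) :=
  NormedModule.Mixin K (norm_NormedModuleAux HN) N 1
    (is_norm_triangle HN) (is_norm_scal HN) (fun _ _ _ H => H)
    (@norm_ball_compat2 K V N) (is_norm_eq_zero HN).

Definition bounded_seq (K : AbsRing) (X : NormedModule K) (x : nat -> X) :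
  Prop := exists M : R, forall n : nat, norm (x n) <= M.

(* The term x(n), n = 1, 2, ..., of the mathematical sequence is [x (n - 1)]. *)
Record linf (K : AbsRing) (X : NormedModule K) : Type := Linf {
  linf_seq :> nat -> X;
  linf_bounded : bounded_seq linf_seq
}.

Lemma linf_ext (K : AbsRing) (X : NormedModule K) (x y : linf X) :
  (forall n, x n = y n) -> x = y.
Proof.
  destruct x as [x hx], y as [y hy]; simpl; intros H.
  assert (E : x = y) by (apply functional_extensionality; exact H).
  subst y. f_equal. apply proof_irrelevance.
Qed.

Lemma bounded_seq_plus (K : AbsRing) (X : NormedModule K) (x y : linf X) :
  bounded_seq (fun n => plus (x n) (y n)).
Proof.
  destruct (linf_bounded x) as [M HM], (linf_bounded y) as [M' HM'].
  exists (M + M'); intros n.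
  eapply Rle_trans; [apply norm_triangle|].
  apply Rplus_le_compat; auto.
Qed.

Lemma bounded_seq_scal (K : AbsRing) (X : NormedModule K) (k : K)
  (x : linf X) : bounded_seq (fun n => scal k (x n)).
Proof.
  destruct (linf_bounded x) as [M HM].
  exists (abs k * M); intros n.
  eapply Rle_trans; [apply norm_scal|].
  apply Rmult_le_compat_l; [apply abs_ge_0|auto].
Qed.

Lemma bounded_seq_opp (K : AbsRing) (X : NormedModule K) (x : linf X) :
  bounded_seq (fun n => opp (x n)).
Proof.
  destruct (linf_bounded x) as [M HM].
  exists M; intros n. rewrite norm_opp; auto.
Qed.

Lemma bounded_seq_zero (K : AbsRing) (X : NormedModule K) :
  bounded_seq (fun _ => zero : X).
Proof. exists 0; intros _. rewrite norm_zero; lra. Qed.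

Definition linf_plus (K : AbsRing) (X : NormedModule K) (x y : linf X) :
  linf X := Linf (bounded_seq_plus x y).
Definition linf_scal (K : AbsRing) (X : NormedModule K) (k : K)
  (x : linf X) : linf X := Linf (bounded_seq_scal k x).
Definition linf_opp (K : AbsRing) (X : NormedModule K) (x : linf X) :
  linf X := Linf (bounded_seq_opp x).
Definition linf_zero (K : AbsRing) (X : NormedModule K) : linf X :=
  Linf (bounded_seq_zero X).

Lemma linf_plus_comm (K : AbsRing) (X : NormedModule K) (x y : linf X) :
  linf_plus x y = linf_plus y x.
Proof. apply linf_ext; intros n; simpl; apply plus_comm. Qed.
Lemma linf_plus_assoc (K : AbsRing) (X : NormedModule K) (x y z : linf X) :
  linf_plus x (linf_plus y z) = linf_plus (linf_plus x y) z.
Proof. apply linf_ext; intros n; simpl; apply plus_assoc. Qed.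
Lemma linf_plus_zero_r (K : AbsRing) (X : NormedModule K) (x : linf X) :
  linf_plus x (linf_zero X) = x.
Proof. apply linf_ext; intros n; simpl; apply plus_zero_r. Qed.
Lemma linf_plus_opp_r (K : AbsRing) (X : NormedModule K) (x : linf X) :
  linf_plus x (linf_opp x) = linf_zero X.
Proof. apply linf_ext; intros n; simpl; exact (plus_opp_r (x n)). Qed.

Definition linf_AbelianMonoid_mixin (K : AbsRing) (X : NormedModule K) :=
  AbelianMonoid.Mixin (linf X) (@linf_plus K X) (linf_zero X)
    (@linf_plus_comm K X) (@linf_plus_assoc K X) (@linf_plus_zero_r K X).

Canonical linf_AbelianMonoid (K : AbsRing) (X : NormedModule K) :=
  AbelianMonoid.Pack (linf X) (linf_AbelianMonoid_mixin X) (linf X).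

Definition linf_AbelianGroup_mixin (K : AbsRing) (X : NormedModule K) :=
  AbelianGroup.Mixin (linf_AbelianMonoid X) (@linf_opp K X)
    (@linf_plus_opp_r K X).

Canonical linf_AbelianGroup (K : AbsRing) (X : NormedModule K) :=
  AbelianGroup.Pack (linf X)
    (AbelianGroup.Class (linf X) (linf_AbelianMonoid_mixin X)
       (linf_AbelianGroup_mixin X)) (linf X).

Lemma linf_scal_assoc (K : AbsRing) (X : NormedModule K) (a b : K)
  (x : linf X) : linf_scal a (linf_scal b x) = linf_scal (mult a b) x.
Proof. apply linf_ext; intros n; simpl; apply scal_assoc. Qed.
Lemma linf_scal_one (K : AbsRing) (X : NormedModule K) (x : linf X) :
  linf_scal one x = x.
Proof. apply linf_ext; intros n; simpl; apply (scal_one (x n)). Qed.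
Lemma linf_scal_distr_l (K : AbsRing) (X : NormedModule K) (a : K)
  (x y : linf X) :
  linf_scal a (plus x y) = plus (linf_scal a x) (linf_scal a y).
Proof. apply linf_ext; intros n; simpl; apply (scal_distr_l a (x n) (y n)). Qed.
Lemma linf_scal_distr_r (K : AbsRing) (X : NormedModule K) (a b : K)
  (x : linf X) :
  linf_scal (plus a b) x = plus (linf_scal a x) (linf_scal b x).
Proof. apply linf_ext; intros n; simpl; apply (scal_distr_r a b (x n)). Qed.

Definition linf_ModuleSpace_mixin (K : AbsRing) (X : NormedModule K) :=
  ModuleSpace.Mixin K (linf_AbelianGroup X) (@linf_scal K X)
    (@linf_scal_assoc K X) (@linf_scal_one K X) (@linf_scal_distr_l K X)
    (@linf_scal_distr_r K X).

Canonical linf_ModuleSpace (K : AbsRing) (X : NormedModule K) :=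
  ModuleSpace.Pack K (linf X)
    (ModuleSpace.Class K (linf X) (AbelianGroup.class (linf_AbelianGroup X))
       (linf_ModuleSpace_mixin X)) (linf X).

Definition sup_norm (K : AbsRing) (X : NormedModule K) (x : linf X) : R :=
  real (Lub_Rbar (fun r => exists n : nat, r = norm (x n))).

Lemma sup_norm_spec (K : AbsRing) (X : NormedModule K) (x : linf X) :
  (forall n, norm (x n) <= sup_norm x) /\
  (forall M, (forall n, norm (x n) <= M) -> sup_norm x <= M).
Proof.
  unfold sup_norm.
  destruct (Lub_Rbar_correct (fun r => exists n : nat, r = norm (x n)))
    as [Hub Hlub].
  destruct (linf_bounded x) as [M0 HM0].
  assert (HB : forall M, (forall n, norm (x n) <= M) ->
    Rbar_le (Lub_Rbar (fun r => exists n : nat, r = norm (x n))) M).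
  { intros M HM. apply Hlub. intros r [n ->]. apply HM. }
  specialize (HB M0 HM0) as HB0.
  specialize (Hub (norm (x O)) (ex_intro _ O eq_refl)) as Hub0.
  destruct (Lub_Rbar (fun r => exists n : nat, r = norm (x n)))
    as [l| |] eqn:E; simpl in *; try contradiction.
  split; [|exact HB].
  intros n. exact (Hub (norm (x n)) (ex_intro _ n eq_refl)).
Qed.

Lemma sup_norm_ge (K : AbsRing) (X : NormedModule K) (x : linf X) (n : nat) :
  norm (x n) <= sup_norm x.
Proof. apply sup_norm_spec. Qed.

Lemma sup_norm_le (K : AbsRing) (X : NormedModule K) (x : linf X) (M : R) :
  (forall n, norm (x n) <= M) -> sup_norm x <= M.
Proof. apply sup_norm_spec. Qed.

Lemma sup_norm_is_norm (K : AbsRing) (X : NormedModule K) :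
  is_norm (@sup_norm K X).
Proof.
  split.
  - intros u v. apply sup_norm_le; intros n.
    eapply Rle_trans; [apply (norm_triangle (u n) (v n))|].
    apply Rplus_le_compat; apply sup_norm_ge.
  - intros k u. apply sup_norm_le; intros n.
    eapply Rle_trans; [apply (norm_scal k (u n))|].
    apply Rmult_le_compat_l; [apply abs_ge_0|apply sup_norm_ge].
  - intros u Hu. apply linf_ext; intros n.
    apply norm_eq_zero, Rle_antisym; [|apply norm_ge_0].
    rewrite <- Hu. apply sup_norm_ge.
Qed.

Canonical linf_UniformSpace (K : AbsRing) (X : NormedModule K) :=
  UniformSpace.Pack (linf X)
    (norm_UniformSpace_mixin (sup_norm_is_norm X)) (linf X).

Canonical linf_NormedModuleAux (K : AbsRing) (X : NormedModule K) :=
  NormedModuleAux.Pack K (linf X)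
    (NormedModuleAux.Class K (linf X)
       (ModuleSpace.class K (linf_ModuleSpace X))
       (norm_UniformSpace_mixin (sup_norm_is_norm X))) (linf X).

Canonical linf_NormedModule (K : AbsRing) (X : NormedModule K) :=
  NormedModule.Pack K (linf X)
    (NormedModule.Class K (linf X)
       (NormedModuleAux.class K (linf_NormedModuleAux X))
       (norm_NormedModule_mixin (sup_norm_is_norm X))) (linf X).

Record closed_subspace (K : AbsRing) (V : NormedModule K) : Type := {
  subspace_mem :> V -> Prop;
  subspace_zero : subspace_mem zero;
  subspace_plus : forall u v : V,
    subspace_mem u -> subspace_mem v -> subspace_mem (plus u v);
  subspace_scal : forall (k : K) (u : V),
    subspace_mem u -> subspace_mem (scal k u);
  subspace_closed : closed subspace_mem
}.

Definition coset (K : AbsRing) (V : NormedModule K) (W : closed_subspace V)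
  (v : V) : V -> Prop := fun u => W (minus u v).

Record quotient (K : AbsRing) (V : NormedModule K) (W : closed_subspace V) :
  Type := Quotient {
  quot_class : V -> Prop;
  quot_class_coset : exists v : V, quot_class = coset W v
}.

Definition quot_proj (K : AbsRing) (V : NormedModule K)
  (W : closed_subspace V) (v : V) : quotient W :=
  Quotient (ex_intro (fun v' => coset W v = coset W v') v eq_refl).

Definition quot_repr (K : AbsRing) (V : NormedModule K)
  (W : closed_subspace V) (a : quotient W) : V :=
  proj1_sig (constructive_indefinite_description _ (quot_class_coset a)).

Lemma quotient_ext (K : AbsRing) (V : NormedModule K)
  (W : closed_subspace V) (a b : quotient W) :
  quot_class a = quot_class b -> a = b.
Proof.
  destruct a as [a ha], b as [b hb]; simpl; intros E. subst b.
  f_equal. apply proof_irrelevance.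
Qed.

Lemma quot_reprK (K : AbsRing) (V : NormedModule K) (W : closed_subspace V)
  (a : quotient W) : quot_proj W (quot_repr a) = a.
Proof.
  apply quotient_ext; simpl. unfold quot_repr.
  destruct (constructive_indefinite_description _ _) as [v Hv]; simpl.
  symmetry; exact Hv.
Qed.

Lemma subspace_opp (K : AbsRing) (V : NormedModule K) (W : closed_subspace V)
  (u : V) : W u -> W (opp u).
Proof.
  intros H. replace (opp u) with (scal (opp one) u) by exact (scal_opp_one u).
  now apply subspace_scal.
Qed.

Lemma quot_proj_eq (K : AbsRing) (V : NormedModule K)
  (W : closed_subspace V) (u v : V) :
  quot_proj W u = quot_proj W v <-> W (minus u v).
Proof.
  split.
  - intros E.
    assert (H : quot_class (quot_proj W u) u).
    { simpl. unfold coset. rewrite minus_eq_zero. apply subspace_zero. }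
    rewrite E in H. exact H.
  - intros H. apply quotient_ext; simpl.
    apply functional_extensionality; intros w.
    apply propositional_extensionality; unfold coset; split; intros Hw.
    + rewrite (minus_trans u w v). now apply subspace_plus.
    + rewrite (minus_trans v w u). apply subspace_plus; [exact Hw|].
      rewrite <- opp_minus. now apply subspace_opp.
Qed.

Lemma quot_class_proj (K : AbsRing) (V : NormedModule K)
  (W : closed_subspace V) (a : quotient W) (v : V) :
  quot_class a v <-> quot_proj W v = a.
Proof.
  rewrite <- (quot_reprK a). rewrite quot_proj_eq. simpl. reflexivity.
Qed.

Definition quot_plus (K : AbsRing) (V : NormedModule K)
  (W : closed_subspace V) (a b : quotient W) : quotient W :=
  quot_proj W (plus (quot_repr a) (quot_repr b)).
Definition quot_scal (K : AbsRing) (V : NormedModule K)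
  (W : closed_subspace V) (k : K) (a : quotient W) : quotient W :=
  quot_proj W (scal k (quot_repr a)).
Definition quot_opp (K : AbsRing) (V : NormedModule K)
  (W : closed_subspace V) (a : quotient W) : quotient W :=
  quot_proj W (opp (quot_repr a)).

Lemma quot_proj_plus (K : AbsRing) (V : NormedModule K)
  (W : closed_subspace V) (u v : V) :
  quot_plus (quot_proj W u) (quot_proj W v) = quot_proj W (plus u v).
Proof.
  apply quot_proj_eq.
  replace (minus _ _)
    with (plus (minus (quot_repr (quot_proj W u)) u)
               (minus (quot_repr (quot_proj W v)) v)).
  - apply subspace_plus; apply quot_proj_eq; apply quot_reprK.
  - symmetry. exact (minus_plus_plus _ _ _ _).
Qed.

Lemma quot_proj_scal (K : AbsRing) (V : NormedModule K)
  (W : closed_subspace V) (k : K) (v : V) :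
  quot_scal k (quot_proj W v) = quot_proj W (scal k v).
Proof.
  apply quot_proj_eq.
  replace (minus _ _) with (scal k (minus (quot_repr (quot_proj W v)) v)).
  - apply subspace_scal, quot_proj_eq, quot_reprK.
  - exact (scal_minus_distr_l _ _ _).
Qed.

Lemma quot_proj_opp (K : AbsRing) (V : NormedModule K)
  (W : closed_subspace V) (v : V) :
  quot_opp (quot_proj W v) = quot_proj W (opp v).
Proof.
  replace (opp v) with (scal (opp one) v) by exact (scal_opp_one v).
  rewrite <- quot_proj_scal. unfold quot_opp, quot_scal. f_equal.
  symmetry. exact (scal_opp_one _).
Qed.

Lemma quot_plus_comm (K : AbsRing) (V : NormedModule K)
  (W : closed_subspace V) (a b : quotient W) :
  quot_plus a b = quot_plus b a.
Proof. unfold quot_plus. now rewrite plus_comm. Qed.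
Lemma quot_plus_assoc (K : AbsRing) (V : NormedModule K)
  (W : closed_subspace V) (a b c : quotient W) :
  quot_plus a (quot_plus b c) = quot_plus (quot_plus a b) c.
Proof.
  rewrite <- (quot_reprK a), <- (quot_reprK b), <- (quot_reprK c).
  rewrite !quot_proj_plus. now rewrite plus_assoc.
Qed.
Lemma quot_plus_zero_r (K : AbsRing) (V : NormedModule K)
  (W : closed_subspace V) (a : quotient W) :
  quot_plus a (quot_proj W zero) = a.
Proof.
  rewrite <- (quot_reprK a), quot_proj_plus. now rewrite plus_zero_r.
Qed.
Lemma quot_plus_opp_r (K : AbsRing) (V : NormedModule K)
  (W : closed_subspace V) (a : quotient W) :
  quot_plus a (quot_opp a) = quot_proj W zero.
Proof.
  rewrite <- (quot_reprK a), quot_proj_opp, quot_proj_plus.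
  f_equal. exact (plus_opp_r (quot_repr a)).
Qed.

Definition quot_AbelianMonoid_mixin (K : AbsRing) (V : NormedModule K)
  (W : closed_subspace V) :=
  AbelianMonoid.Mixin (quotient W) (@quot_plus K V W) (quot_proj W zero)
    (@quot_plus_comm K V W) (@quot_plus_assoc K V W)
    (@quot_plus_zero_r K V W).

Canonical quot_AbelianMonoid (K : AbsRing) (V : NormedModule K)
  (W : closed_subspace V) :=
  AbelianMonoid.Pack (quotient W) (quot_AbelianMonoid_mixin W) (quotient W).

Definition quot_AbelianGroup_mixin (K : AbsRing) (V : NormedModule K)
  (W : closed_subspace V) :=
  AbelianGroup.Mixin (quot_AbelianMonoid W) (@quot_opp K V W)
    (@quot_plus_opp_r K V W).

Canonical quot_AbelianGroup (K : AbsRing) (V : NormedModule K)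
  (W : closed_subspace V) :=
  AbelianGroup.Pack (quotient W)
    (AbelianGroup.Class (quotient W) (quot_AbelianMonoid_mixin W)
       (quot_AbelianGroup_mixin W)) (quotient W).

Lemma quot_scal_assoc (K : AbsRing) (V : NormedModule K)
  (W : closed_subspace V) (k l : K) (a : quotient W) :
  quot_scal k (quot_scal l a) = quot_scal (mult k l) a.
Proof.
  rewrite <- (quot_reprK a), !quot_proj_scal. now rewrite scal_assoc.
Qed.
Lemma quot_scal_one (K : AbsRing) (V : NormedModule K)
  (W : closed_subspace V) (a : quotient W) : quot_scal one a = a.
Proof.
  rewrite <- (quot_reprK a), quot_proj_scal.
  now rewrite (scal_one (quot_repr a)).
Qed.
Lemma quot_scal_distr_l (K : AbsRing) (V : NormedModule K)
  (W : closed_subspace V) (k : K) (a b : quotient W) :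
  quot_scal k (plus a b) = plus (quot_scal k a) (quot_scal k b).
Proof.
  change (quot_scal k (quot_plus a b)
          = quot_plus (quot_scal k a) (quot_scal k b)).
  rewrite <- (quot_reprK a), <- (quot_reprK b).
  rewrite quot_proj_plus, !quot_proj_scal, quot_proj_plus.
  f_equal. exact (scal_distr_l k (quot_repr a) (quot_repr b)).
Qed.
Lemma quot_scal_distr_r (K : AbsRing) (V : NormedModule K)
  (W : closed_subspace V) (k l : K) (a : quotient W) :
  quot_scal (plus k l) a = plus (quot_scal k a) (quot_scal l a).
Proof.
  change (quot_scal (plus k l) a
          = quot_plus (quot_scal k a) (quot_scal l a)).
  rewrite <- (quot_reprK a), !quot_proj_scal, quot_proj_plus.
  f_equal. exact (scal_distr_r k l (quot_repr a)).
Qed.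

Definition quot_ModuleSpace_mixin (K : AbsRing) (V : NormedModule K)
  (W : closed_subspace V) :=
  ModuleSpace.Mixin K (quot_AbelianGroup W) (@quot_scal K V W)
    (@quot_scal_assoc K V W) (@quot_scal_one K V W)
    (@quot_scal_distr_l K V W) (@quot_scal_distr_r K V W).

Canonical quot_ModuleSpace (K : AbsRing) (V : NormedModule K)
  (W : closed_subspace V) :=
  ModuleSpace.Pack K (quotient W)
    (ModuleSpace.Class K (quotient W)
       (AbelianGroup.class (quot_AbelianGroup W))
       (quot_ModuleSpace_mixin W)) (quotient W).

Definition quot_norm (K : AbsRing) (V : NormedModule K)
  (W : closed_subspace V) (a : quotient W) : R :=
  real (Glb_Rbar (fun r => exists v : V, quot_class a v /\ r = norm v)).

Lemma quot_norm_spec (K : AbsRing) (V : NormedModule K)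
  (W : closed_subspace V) (a : quotient W) :
  (forall v, quot_proj W v = a -> quot_norm a <= norm v) /\
  (forall m, (forall v, quot_proj W v = a -> m <= norm v) -> m <= quot_norm a).
Proof.
  unfold quot_norm.
  set (E := fun r => exists v : V, quot_class a v /\ r = norm v).
  destruct (Glb_Rbar_correct E) as [Hlb Hglb].
  assert (HB : forall m, (forall v, quot_proj W v = a -> m <= norm v) ->
    Rbar_le m (Glb_Rbar E)).
  { intros m Hm. apply Hglb. intros r [v [Hv ->]]. simpl.
    apply Hm. now apply quot_class_proj. }
  assert (HL : forall v, quot_proj W v = a -> Rbar_le (Glb_Rbar E) (norm v)).
  { intros v Hv. apply Hlb. exists v. split; [|reflexivity].
    now apply quot_class_proj. }
  pose proof (HB 0 (fun v _ => norm_ge_0 v)) as H0.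
  pose proof (HL _ (quot_reprK a)) as H1.
  destruct (Glb_Rbar E) as [l| |]; simpl in *; try contradiction.
  split; [exact HL|exact HB].
Qed.

Lemma quot_norm_le (K : AbsRing) (V : NormedModule K)
  (W : closed_subspace V) (v : V) : quot_norm (quot_proj W v) <= norm v.
Proof. now apply quot_norm_spec. Qed.

Lemma quot_norm_ge (K : AbsRing) (V : NormedModule K)
  (W : closed_subspace V) (a : quotient W) (m : R) :
  (forall v, quot_proj W v = a -> m <= norm v) -> m <= quot_norm a.
Proof. apply quot_norm_spec. Qed.

Lemma quot_norm_approx (K : AbsRing) (V : NormedModule K)
  (W : closed_subspace V) (a : quotient W) (e : R) :
  0 < e -> exists v, quot_proj W v = a /\ norm v < quot_norm a + e.
Proof.
  intros He. apply NNPP; intros Hn.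
  assert (H : quot_norm a + e <= quot_norm a); [|lra].
  apply quot_norm_ge. intros v Hv.
  destruct (Rlt_le_dec (norm v) (quot_norm a + e)) as [H|H]; [|exact H].
  exfalso; apply Hn; exists v; now split.
Qed.

Lemma quot_norm_is_norm (K : AbsRing) (V : NormedModule K)
  (W : closed_subspace V) : is_norm (@quot_norm K V W).
Proof.
  split.
  - intros a b. apply le_epsilon; intros e He.
    destruct (@quot_norm_approx _ _ _ a (e / 2)) as [u [<- Hu]]; [lra|].
    destruct (@quot_norm_approx _ _ _ b (e / 2)) as [v [<- Hv]]; [lra|].
    change (plus (quot_proj W u) (quot_proj W v))
      with (quot_plus (quot_proj W u) (quot_proj W v)).
    rewrite quot_proj_plus.
    eapply Rle_trans; [apply quot_norm_le|].
    eapply Rle_trans; [apply norm_triangle|]. lra.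
  - intros k a. apply le_epsilon; intros e He.
    assert (Hk : 0 <= abs k) by apply abs_ge_0.
    destruct (@quot_norm_approx _ _ _ a (e / (abs k + 1))) as [u [<- Hu]].
    { apply Rdiv_lt_0_compat; lra. }
    change (scal k (quot_proj W u)) with (quot_scal k (quot_proj W u)).
    rewrite quot_proj_scal.
    eapply Rle_trans; [apply quot_norm_le|].
    eapply Rle_trans; [apply norm_scal|].
    eapply Rle_trans;
      [apply Rmult_le_compat_l; [exact Hk|apply Rlt_le, Hu]|].
    rewrite Rmult_plus_distr_l. apply Rplus_le_compat_l.
    replace e with ((abs k + 1) * (e / (abs k + 1))) at 2 by (field; lra).
    apply Rmult_le_compat_r; [|lra].
    apply Rlt_le, Rdiv_lt_0_compat; lra.
  - intros a Ha. rewrite <- (quot_reprK a).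
    assert (HW : W (quot_repr a)).
    { apply (subspace_closed (c := W)). intros Hloc.
      destruct (locally_norm_le_locally _ _ Hloc) as [e He].
      destruct (@quot_norm_approx _ _ _ a e (cond_pos e)) as [v [Hv Hve]].
      rewrite Ha, Rplus_0_l in Hve.
      apply (He (minus (quot_repr a) v)).
      - unfold ball_norm.
        replace (minus (minus (quot_repr a) v) (quot_repr a)) with (opp v).
        + now rewrite norm_opp.
        + symmetry. exact (minus_minus_l _ _).
      - apply quot_proj_eq. now rewrite quot_reprK. }
    apply quot_proj_eq. refine (eq_ind_r (subspace_mem W) HW _).
    exact (minus_zero_r _).
Qed.

Canonical quot_UniformSpace (K : AbsRing) (V : NormedModule K)
  (W : closed_subspace V) :=
  UniformSpace.Pack (quotient W)
    (norm_UniformSpace_mixin (quot_norm_is_norm W)) (quotient W).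

Canonical quot_NormedModuleAux (K : AbsRing) (V : NormedModule K)
  (W : closed_subspace V) :=
  NormedModuleAux.Pack K (quotient W)
    (NormedModuleAux.Class K (quotient W)
       (ModuleSpace.class K (quot_ModuleSpace W))
       (norm_UniformSpace_mixin (quot_norm_is_norm W))) (quotient W).

Canonical quot_NormedModule (K : AbsRing) (V : NormedModule K)
  (W : closed_subspace V) :=
  NormedModule.Pack K (quotient W)
    (NormedModule.Class K (quotient W)
       (NormedModuleAux.class K (quot_NormedModuleAux W))
       (norm_NormedModule_mixin (quot_norm_is_norm W))) (quotient W).

(* Meaningful when [f] is linear and maps [W] into itself: see
   [quot_map_proj]. *)
Definition quot_map (K : AbsRing) (V : NormedModule K)
  (W : closed_subspace V) (f : V -> V) (a : quotient W) : quotient W :=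
  quot_proj W (f (quot_repr a)).

Lemma quot_map_proj (K : AbsRing) (V : NormedModule K)
  (W : closed_subspace V) (f : V -> V) :
  (forall u v, f (minus u v) = minus (f u) (f v)) ->
  (forall w, W w -> W (f w)) ->
  forall v, quot_map f (quot_proj W v) = quot_proj W (f v).
Proof.
  intros Hf HW v. apply quot_proj_eq. rewrite <- Hf.
  apply HW, quot_proj_eq, quot_reprK.
Qed.

Definition is_c0 (K : AbsRing) (X : NormedModule K) (x : linf X) : Prop :=
  filterlim x eventually (locally (zero : X)).

Lemma norm_minus_zero (K : AbsRing) (V : NormedModule K) (u : V) :
  norm (minus u zero) = norm u.
Proof. f_equal. exact (minus_zero_r u). Qed.

Lemma is_c0_norm (K : AbsRing) (X : NormedModule K) (x : linf X) :
  is_c0 x <->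
  forall e : posreal, exists N, forall n, (N <= n)%nat -> norm (x n) < e.
Proof.
  unfold is_c0.
  split.
  - intros H e.
    destruct (proj1 (filterlim_locally_ball_norm (x : nat -> X) zero) H e)
      as [N HN].
    exists N; intros n Hn. specialize (HN n Hn).
    eapply Rle_lt_trans; [right; symmetry; apply norm_minus_zero|exact HN].
  - intros H. apply (filterlim_locally_ball_norm (x : nat -> X)).
    intros e. destruct (H e) as [N HN]. exists N; intros n Hn.
    eapply Rle_lt_trans; [right; apply norm_minus_zero|now apply HN].
Qed.

Lemma is_c0_zero (K : AbsRing) (X : NormedModule K) :
  is_c0 (zero : linf X).
Proof.
  apply is_c0_norm. intros e; exists O; intros n _.
  change (norm (zero : X) < e). rewrite norm_zero. apply cond_pos.
Qed.

Lemma is_c0_plus (K : AbsRing) (X : NormedModule K) (x y : linf X) :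
  is_c0 x -> is_c0 y -> is_c0 (plus x y).
Proof.
  rewrite !is_c0_norm. intros Hx Hy e.
  destruct (Hx (pos_div_2 e)) as [N1 H1], (Hy (pos_div_2 e)) as [N2 H2].
  exists (Nat.max N1 N2); intros n Hn.
  change (norm (plus (x n) (y n)) < e).
  eapply Rle_lt_trans; [apply norm_triangle|].
  rewrite <- (Rplus_half_diag e). apply Rplus_lt_compat.
  - apply H1. eapply Nat.le_trans; [apply Nat.le_max_l|exact Hn].
  - apply H2. eapply Nat.le_trans; [apply Nat.le_max_r|exact Hn].
Qed.

Lemma is_c0_scal (K : AbsRing) (X : NormedModule K) (k : K) (x : linf X) :
  is_c0 x -> is_c0 (scal k x).
Proof.
  rewrite !is_c0_norm. intros Hx e.
  assert (Hk : 0 <= abs k) by apply abs_ge_0.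
  assert (He : 0 < e / (abs k + 1)).
  { apply Rdiv_lt_0_compat; [apply cond_pos|lra]. }
  destruct (Hx (mkposreal _ He)) as [N HN]; simpl in HN.
  exists N; intros n Hn. specialize (HN n Hn).
  change (norm (scal k (x n)) < e).
  eapply Rle_lt_trans; [apply norm_scal|].
  apply Rle_lt_trans with (abs k * (e / (abs k + 1))).
  - apply Rmult_le_compat_l; [exact Hk|now apply Rlt_le].
  - apply Rlt_le_trans with ((abs k + 1) * (e / (abs k + 1))).
    + apply Rmult_lt_compat_r; lra.
    + right; field; lra.
Qed.

Lemma is_c0_closed (K : AbsRing) (X : NormedModule K) :
  closed (@is_c0 K X).
Proof.
  intros x Hx. apply is_c0_norm. intros e.
  assert (H : exists y : linf X, sup_norm (minus y x) < e / 2 /\ is_c0 y).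
  { apply NNPP; intros Hn. apply Hx.
    exists (pos_div_2 e). intros y Hy Hc. apply Hn. exists y; now split. }
  destruct H as [y [Hyx Hy]].
  destruct (proj1 (is_c0_norm y) Hy (pos_div_2 e)) as [N HN]; simpl in HN.
  exists N; intros n Hn. specialize (HN n Hn).
  pose proof (sup_norm_ge (minus y x) n) as Hs.
  change (norm (minus (y n) (x n)) <= sup_norm (minus y x)) in Hs.
  replace (x n) with (plus (y n) (opp (minus (y n) (x n)))).
  - eapply Rle_lt_trans; [apply norm_triangle|]. rewrite norm_opp. lra.
  - exact (plus_opp_minus _ _).
Qed.

Definition c0 (K : AbsRing) (X : NormedModule K) :
  closed_subspace (linf_NormedModule X) :=
  Build_closed_subspace (V := linf_NormedModule X)
    (@is_c0_zero K X) (@is_c0_plus K X) (@is_c0_scal K X) (@is_c0_closed K X).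

Definition linf_mod_c0 (K : AbsRing) (X : NormedModule K) :
  NormedModule K := quot_NormedModule (c0 X).

Definition linf_bar (K : AbsRing) (X : NormedModule K) (x : linf X) :
  linf_mod_c0 X := quot_proj (c0 X) x.

Lemma bounded_seq_shift (K : AbsRing) (X : NormedModule K) (x : linf X) :
  bounded_seq (fun n => x (S n)).
Proof. destruct (linf_bounded x) as [M HM]. exists M; intros n; auto. Qed.

Definition shift (K : AbsRing) (X : NormedModule K) (x : linf X) : linf X :=
  Linf (bounded_seq_shift x).

Definition shift_bar (K : AbsRing) (X : NormedModule K) :
  linf_mod_c0 X -> linf_mod_c0 X := quot_map (W := c0 X) (@shift K X).

Lemma shift_barE (K : AbsRing) (X : NormedModule K) (x : linf X) :
  shift_bar (linf_bar x) = linf_bar (shift x).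
Proof.
  apply (quot_map_proj (W := c0 X)).
  - intros u v. now apply linf_ext.
  - intros w Hw. apply is_c0_norm. intros e.
    destruct (proj1 (is_c0_norm w) Hw e) as [N HN].
    exists N; intros n Hn. apply HN. now apply Nat.le_trans with n; auto.
Qed.

Definition is_resolvent (V : NormedModule C_AbsRing) (A : V -> V) (l : C)
  (B : V -> V) : Prop :=
  is_linear B /\
  (forall v : V, minus (scal l (B v)) (A (B v)) = v) /\
  (forall v : V, B (minus (scal l v) (A v)) = v).

(* The bounded inverse of [l - A]; unspecified when [l] is not in the
   resolvent set of [A]. *)
Definition resolvent (V : NormedModule C_AbsRing) (l : C) (A : V -> V) :
  V -> V :=
  epsilon (inhabits (fun _ : V => zero : V)) (is_resolvent A l).

(* Local expansion in a power series; only meant for open [U], as the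
   expansion around [z] must represent [f] on a full disc. *)
Definition analytic_on (V : NormedModule C_AbsRing) (U : C -> Prop)
  (f : C -> V) : Prop :=
  forall z : C, U z ->
    exists (a : nat -> V) (r : posreal),
      forall w : C, Cmod (w - z) < r ->
        is_pseries (K := C_AbsRing) a (w - z)%C (f w).

Definition resolvent_orbit (X : NormedModule C_AbsRing) (x : linf X) (l : C) :
  linf_mod_c0 X := resolvent l (@shift_bar C_AbsRing X) (linf_bar x).

Definition seq_spectrum (X : NormedModule C_AbsRing) (x : linf X) (xi : C) :
  Prop :=
  Cmod xi = 1 /\
  ~ exists (U : C -> Prop) (h : C -> linf_mod_c0 X),
      open U /\ U xi /\ analytic_on U h /\
      forall l : C, U l -> Cmod l <> 1 -> h l = resolvent_orbit x l.

Definition countable (T : Type) (A : T -> Prop) : Prop :=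
  exists f : nat -> T, forall t : T, A t -> exists n : nat, f n = t.

(* For [z = r e^{i phi}] with [r > 0], the point [s / r * z] is
   [s e^{i phi}]. *)
Definition is_dir_lim (V : NormedModule C_AbsRing) (F : C -> V) (z : C)
  (l : V) : Prop :=
  filterlim (fun s : R => F (RtoC (s / Cmod z) * z)%C) (at_right (Cmod z))
    (locally l).

(* Main.v *)
(** Put [y = x-bar] and let [T] be the induced shift, an invertible isometry of
    [linf/c0].  The proof is Riemann's and Cantor's uniqueness argument for the
    trigonometric series [sum_n e^(-int) T^n y], [n] ranging over the integers.
    Its formal second primitive [F] is a continuous vector-valued function of
    [t].  If [xi = e^(it)] is regular, then comparing the first two orders of
    [(l - T) g(l) = y] at [l = xi] gives [y = (xi - T)^2 v], and summation by
    parts shows that the second symmetric difference of [F] at [t] is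
    [O(h^3)].  If [xi] is singular, the limit condition puts [y] into the closure
    of the range of [(xi - T)^2], and the difference is [o(h)].  Subtracting
    from [F] its affine interpolant on [[0, 4 pi]] and taking norms yields a real
    function to which the maximum principle of Schwarz, with a countable exceptional
    set, applies; hence [F] is affine there, and its second difference of step
    [2 pi], which equals [(2 pi)^2 y], vanishes. *)
Require Import Defs.
From Stdlib Require Import Reals Lra Lia Classical ClassicalEpsilon List.
From Coquelicot Require Import Coquelicot.

Open Scope R_scope.
Set Bullet Behavior "Strict Subproofs".

(** * A maximum principle for symmetric second differences *)

(** Two orders of magnitude carry the argument. With U = e^(-it) T, the second difference of F at t
    with step h is the sum over all integers n of c_n U^n y, where c_n is the integral of the tent h
    - |s| against cos (n s) over |s| <= h. The c_n sum to O(h), but their second differences in n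
    sum to O(h^3), because such a difference multiplies the tent by 2 - 2 cos s <= s^2. Up to an
    invertible factor (xi - T)^2 is 2 - U - U^-1, which acts on the orbit as minus a second
    difference in n. So the part of y in its range costs O(h^3), and a remainder e costs O(h) times
    its norm. This is why the square must be reached; at a singular point it comes from squaring 1 =
    d R + (xi - T) R, with R the resolvent at xi + d and d R y small.

    The values are vectors, while the maximum principle concerns real functions. By the triangle
    inequality the norm has second differences bounded below, and the principle is therefore stated
    with lower bounds. The length 4 pi lets the second difference of step 2 pi about the midpoint
    stay inside the interval. *)

Lemma interval_uncountable (g : nat -> R) (a b : R) :
  a < b -> exists m, a < m < b /\ forall n, g n <> m.
Proof.
  intros Hab.
  (* Cantor's nested intervals: the step keeps the outer third lying beyond the midpoint from [x],
     which therefore excludes [x]. Starting from the middle third keeps the limit away from [a] and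
     [b]. *)
  set (step := fun (x : R) (I : R * R) =>
    let (l, r) := I in
    if Rle_dec x ((l + r) / 2) then (r - (r - l) / 3, r)
    else (l, l + (r - l) / 3)).
  set (I := fix I n := match n with
    | O => (a + (b - a) / 3, b - (b - a) / 3)
    | S n => step (g n) (I n) end).
  assert (HS : forall n, fst (I n) < snd (I n) /\
    fst (I n) <= fst (I (S n)) /\ snd (I (S n)) <= snd (I n) /\
    (g n < fst (I (S n)) \/ snd (I (S n)) < g n)).
  { assert (P : forall n, fst (I n) < snd (I n)).
    { induction n as [|n IH]; [simpl; lra|].
      change (I (S n)) with (step (g n) (I n)).
      destruct (I n) as [l r]; unfold step; simpl in *.
      destruct (Rle_dec _ _); simpl; lra. }
    intros n. specialize (P n). split; [exact P|].
    change (I (S n)) with (step (g n) (I n)).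
    destruct (I n) as [l r]; unfold step; simpl in *.
    destruct (Rle_dec _ _); simpl; lra. }
  assert (Hmono : forall n k,
    fst (I n) <= fst (I (n + k)%nat) /\ snd (I (n + k)%nat) <= snd (I n)).
  { intros n; induction k as [|k IH]; [rewrite Nat.add_0_r; lra|].
    rewrite Nat.add_succ_r. pose proof (HS (n + k)%nat). lra. }
  assert (Hlr : forall n k, fst (I n) <= snd (I k)).
  { intros n k. pose proof (Hmono n k). pose proof (Hmono k n).
    rewrite (Nat.add_comm k n) in H0. pose proof (HS (n + k)%nat). lra. }
  destruct (completeness (fun x => exists n, x = fst (I n))) as [m [Hub Hlub]].
  - exists (snd (I O)). intros x [n ->]. apply Hlr.
  - exists (fst (I O)). now exists O.
  - assert (Hl : forall n, fst (I n) <= m) by (intros n; apply Hub; now exists n).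
    assert (Hr : forall n, m <= snd (I n)).
    { intros n. apply Hlub. intros x [k ->]. apply Hlr. }
    exists m. split.
    + pose proof (Hl O). pose proof (Hr O). simpl in *. lra.
    + intros n E. pose proof (HS n). pose proof (Hl (S n)).
      pose proof (Hr (S n)). lra.
Qed.

Lemma exists_pos_below (d d' : R) :
  0 < d -> 0 < d' -> exists h, 0 < h /\ h < d /\ h < d'.
Proof.
  intros H H'. exists (Rmin d d' / 2). pose proof (Rmin_pos _ _ H H').
  pose proof (Rmin_l d d'). pose proof (Rmin_r d d'). lra.
Qed.

(* A positive value of [u] would give [u + eta (t - a)^2 - m (t - a)] an
   interior maximum for every small slope [m]; there the quadratic term
   excludes the first alternative, and the second makes [m] the derivative of
   [u + eta (t - a)^2], so that the countably many points of [f] would carry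
   uncountably many slopes. *)
Lemma schwarz_maximum_principle (u : R -> R) (a b : R) (f : nat -> R) :
  a < b ->
  (forall t, a <= t <= b -> continuity_pt u t) ->
  u a <= 0 -> u b <= 0 ->
  (forall t, a < t < b ->
    (forall eps, 0 < eps -> exists delta, 0 < delta /\
       forall h, 0 < h < delta ->
         - eps * h ^ 2 <= u (t + h) + u (t - h) - 2 * u t) \/
    ((exists n, f n = t) /\
     forall eps, 0 < eps -> exists delta, 0 < delta /\
       forall h, 0 < h < delta ->
         - eps * h <= u (t + h) + u (t - h) - 2 * u t)) ->
  forall t, a <= t <= b -> u t <= 0.
Proof.
  intros Hab Hu Ha Hb Hd c Hc. apply Rnot_lt_le; intros Huc.
  (* [eta] and [m0] are chosen so that on [[a, b]] the quadratic term and the linear term with slope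
     below [m0] each amount to at most [u c / 4]. Hence [v c > 3 / 4 * u c], whereas [v a <= 0] and
     [v b < u c / 4], so the maximum of [v] is interior. *)
  set (eta := u c / (4 * (b - a) ^ 2)).
  assert (Heta : 0 < eta).
  { apply Rdiv_lt_0_compat; [lra|].
    apply Rmult_lt_0_compat; [lra|apply pow_lt; lra]. }
  assert (Eeta : eta * (b - a) ^ 2 = u c / 4) by (unfold eta; field; lra).
  set (m0 := u c / (4 * (b - a))).
  assert (Em0 : m0 * (b - a) = u c / 4) by (unfold m0; field; lra).
  assert (Hm0 : 0 < m0) by (apply Rdiv_lt_0_compat; lra).
  (* [P n m]: the right derivative of [u + eta (t - a)^2] at [f n] is [m]. Uniqueness of this
     derivative lets one sequence list all slopes that can occur. *)
  set (P := fun n m => forall eps, 0 < eps -> exists delta, 0 < delta /\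
    forall h, 0 < h < delta ->
      Rabs (u (f n + h) + eta * (f n + h - a) ^ 2
            - (u (f n) + eta * (f n - a) ^ 2) - m * h) <= eps * h).
  assert (Hinj : forall n m m', P n m -> P n m' -> m = m').
  { intros n m m' H H'. apply cond_eq. intros eps Heps.
    destruct (H (eps / 4)) as [d [Hd1 Hd2]]; [lra|].
    destruct (H' (eps / 4)) as [d' [Hd1' Hd2']]; [lra|].
    destruct (exists_pos_below _ _ Hd1 Hd1') as [h [Hh [Hhd Hhd']]].
    assert (A1 := Hd2 h ltac:(lra)). assert (A2 := Hd2' h ltac:(lra)).
    apply Rabs_le_between in A1. apply Rabs_le_between in A2.
    apply Rmult_lt_reg_r with h; [exact Hh|].
    rewrite <- (Rabs_pos_eq h) at 1 by lra. rewrite <- Rabs_mult.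
    apply Rle_lt_trans with (eps / 2 * h); [|apply Rmult_lt_compat_r; lra].
    apply Rabs_le. lra. }
  (* At an [f n] without right derivative [g n] is an arbitrary value, which is harmless: avoiding
     it only excludes one more slope. *)
  set (g := fun n => epsilon (inhabits 0) (P n)).
  destruct (interval_uncountable g 0 m0 Hm0) as [m [Hm Hgm]].
  set (v := fun t => u t + (eta * (t - a) ^ 2 - m * (t - a))).
  destruct (continuity_ab_maj v a b) as [t [Ht Hti]]; [lra| |].
  { intros t Ht. apply continuity_pt_plus; [now apply Hu|].
    apply derivable_continuous_pt. exists (eta * (2 * (t - a)) - m).
    apply is_derive_Reals. auto_derive; [trivial|ring]. }
  assert (Hvc : v c <= v t) by (apply Ht; lra).
  assert (Hvc' : u c - u c / 4 < v c).
  { unfold v. assert (0 <= eta * (c - a) ^ 2).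
    { apply Rmult_le_pos; [lra|apply pow2_ge_0]. }
    assert (m * (c - a) <= m * (b - a)) by (apply Rmult_le_compat_l; lra).
    assert (m * (b - a) < m0 * (b - a)) by (apply Rmult_lt_compat_r; lra).
    lra. }
  assert (Hta : a < t < b).
  { split; apply Rnot_le_lt; intros Hle.
    - assert (t = a) by lra. subst t. unfold v at 2 in Hvc.
      replace (eta * (a - a) ^ 2 - m * (a - a)) with 0 in Hvc by ring. lra.
    - assert (t = b) by lra. subst t. unfold v at 2 in Hvc.
      assert (0 < m * (b - a)) by (apply Rmult_lt_0_compat; lra).
      lra. }
  set (d0 := Rmin (t - a) (b - t)).
  assert (Hd0 : 0 < d0) by (apply Rmin_pos; lra).
  assert (Hd0l : d0 <= t - a) by apply Rmin_l.
  assert (Hd0r : d0 <= b - t) by apply Rmin_r.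
  assert (Hmax : forall h, 0 < h < d0 -> v (t + h) <= v t /\ v (t - h) <= v t).
  { intros h Hh. split; apply Ht; lra. }
  assert (Hv2 : forall h, v (t + h) + v (t - h) - 2 * v t =
    u (t + h) + u (t - h) - 2 * u t + 2 * eta * h ^ 2).
  { intros h. unfold v. ring. }
  destruct (Hd t Hta) as [H|[[n Hn] H]].
  - destruct (H eta Heta) as [d [Hd1 Hd2]].
    destruct (exists_pos_below _ _ Hd1 Hd0) as [h [Hh [Hhd Hhd0]]].
    specialize (Hd2 h ltac:(lra)). specialize (Hmax h ltac:(lra)).
    specialize (Hv2 h).
    assert (0 < eta * h ^ 2) by (apply Rmult_lt_0_compat; [lra|apply pow_lt; lra]).
    lra.
  - subst t. apply (Hgm n). assert (HP : P n m).
    (* At the maximum [v (t + h) - v t <= 0]. It is also the second difference of [v] minus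
       [v (t - h) - v t <= 0], hence at least [- eps * h]; so [v] has right derivative 0. *)
    { intros eps Heps. destruct (H eps Heps) as [d [Hd1 Hd2]].
      exists (Rmin d d0). split; [now apply Rmin_pos|].
      intros h Hh. pose proof (Rmin_l d d0). pose proof (Rmin_r d d0).
      specialize (Hd2 h ltac:(lra)). specialize (Hmax h ltac:(lra)).
      specialize (Hv2 h).
      assert (0 <= eta * h ^ 2) by (apply Rmult_le_pos; [lra|apply pow2_ge_0]).
      replace (u (f n + h) + eta * (f n + h - a) ^ 2
        - (u (f n) + eta * (f n - a) ^ 2) - m * h) with (v (f n + h) - v (f n))
        by (unfold v; ring).
      apply Rabs_le. lra. }
    apply Hinj with n; [|exact HP].
    unfold g. apply epsilon_spec. now exists m.
Qed.

(** * Fourier coefficients of the tent function *)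

Lemma Rabs_sin_le (x : R) : 0 <= x -> Rabs (sin x) <= x.
Proof.
  intros Hx. destruct (Rle_lt_dec x 1) as [H1|H1].
  - destruct Hx as [Hx|<-]; [|rewrite sin_0, Rabs_R0; lra].
    rewrite Rabs_pos_eq; [left; now apply sin_lt_x|].
    apply sin_ge_0; [lra|pose proof PI2_1; lra].
  - apply Rle_trans with 1; [|lra]. apply Rabs_le, SIN_bound.
Qed.

Lemma two_minus_two_cos (x : R) :
  0 <= x -> 0 <= 2 - 2 * cos x <= x ^ 2 /\ 2 - 2 * cos x <= 4.
Proof.
  intros Hx. pose proof (COS_bound x) as Hc.
  assert (E : cos x = 1 - 2 * sin (x / 2) * sin (x / 2)).
  { rewrite <- cos_2a_sin. f_equal. field. }
  assert (Hs : Rabs (sin (x / 2)) <= x / 2) by (apply Rabs_sin_le; lra).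
  pose proof (Rmult_le_compat _ _ _ _ (Rabs_pos _) (Rabs_pos _) Hs Hs) as H.
  rewrite <- Rabs_mult, Rabs_pos_eq in H by apply Rle_0_sqr. lra.
Qed.

Lemma increment_bound (f df : R -> R) (h B : R) :
  0 <= h -> (forall s, 0 <= s <= h -> is_derive f s (df s)) ->
  (forall s, 0 <= s <= h -> Rabs (df s) <= B) ->
  Rabs (f h - f 0) <= B * h.
Proof.
  intros Hh Hd HB.
  destruct (MVT_gen f 0 h df) as [c [Hc ->]].
  - intros s Hs. rewrite Rmin_left, Rmax_right in Hs by lra. apply Hd; lra.
  - intros s Hs. rewrite Rmin_left, Rmax_right in Hs by lra.
    apply derivable_continuous_pt. exists (df s).
    apply is_derive_Reals, Hd; lra.
  - rewrite Rmin_left, Rmax_right in Hc by lra.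
    rewrite Rminus_0_r, Rabs_mult, (Rabs_pos_eq h) by lra.
    apply Rmult_le_compat_r; [lra|now apply HB].
Qed.

(* [h^2] times the squared cardinal sine of [n h / 2]. *)
Definition riemann_coef (h : R) (n : nat) : R :=
  match n with
  | O => h ^ 2
  | S _ => (2 - 2 * cos (INR n * h)) / INR n ^ 2
  end.

(** An antiderivative of [(h - s) * cos (n * s)]. Twice its increment over [[0, h]] is the Fourier
    integral of the tent [h - |s|]; in this form a difference in [n] can be estimated under the
    integral sign. *)
Definition tent_primitive (h : R) (n : nat) (s : R) : R :=
  match n with
  | O => h * s - s ^ 2 / 2
  | S _ => (h - s) * sin (INR n * s) / INR n - cos (INR n * s) / INR n ^ 2
  end.

Lemma is_derive_tent_primitive (h : R) (n : nat) (s : R) :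
  is_derive (tent_primitive h n) s ((h - s) * cos (INR n * s)).
Proof.
  destruct n as [|n]; unfold tent_primitive.
  - auto_derive; [trivial|]. change (INR 0) with 0.
    rewrite Rmult_0_l, cos_0. lra.
  - assert (H : INR (S n) <> 0) by (apply not_0_INR; lia).
    set (x := INR (S n)) in *. clearbody x.
    auto_derive; [trivial|]. field. exact H.
Qed.

Lemma tent_primitive_increment (h : R) (n : nat) :
  2 * (tent_primitive h n h - tent_primitive h n 0) = riemann_coef h n.
Proof.
  destruct n as [|n]; unfold tent_primitive, riemann_coef.
  - field.
  - assert (H : INR (S n) <> 0) by (apply not_0_INR; lia).
    rewrite !Rmult_0_r, sin_0, cos_0. field. exact H.
Qed.

(** Since [pred 0 = 0], the value at [n = 0] is [riemann_coef h 0 - riemann_coef h 1], half of the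
    symmetric second difference. This is the boundary coefficient that summation by parts over
    [n >= 0] produces. *)
Definition riemann_coef_diff2 (h : R) (n : nat) : R :=
  2 * riemann_coef h n - riemann_coef h (S n) - riemann_coef h (pred n).

Lemma riemann_coef_pos (h : R) (n : nat) : 0 <= h -> 0 <= riemann_coef h n.
Proof.
  intros Hh. destruct n as [|n]; [apply pow2_ge_0|].
  assert (Hn : 0 < INR (S n)) by (apply lt_0_INR; lia). unfold riemann_coef.
  apply Rmult_le_pos; [|left; apply Rinv_0_lt_compat, pow_lt, Hn].
  apply two_minus_two_cos. apply Rmult_le_pos; lra.
Qed.

Lemma riemann_coef_le_sqr (h : R) (n : nat) :
  0 <= h -> riemann_coef h n <= h ^ 2.
Proof.
  intros Hh. destruct n as [|n]; [simpl; lra|].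
  assert (Hn : 0 < INR (S n)) by (apply lt_0_INR; lia). unfold riemann_coef.
  apply Rle_div_l; [apply pow_lt, Hn|].
  rewrite <- Rpow_mult_distr, (Rmult_comm h).
  apply two_minus_two_cos. apply Rmult_le_pos; lra.
Qed.

Lemma riemann_coef_le_inv_sqr (h : R) (n : nat) :
  0 <= h -> riemann_coef h (S n) <= 4 / INR (S n) ^ 2.
Proof.
  intros Hh. assert (Hn : 0 < INR (S n)) by (apply lt_0_INR; lia).
  unfold riemann_coef.
  apply Rmult_le_compat_r; [left; apply Rinv_0_lt_compat, pow_lt, Hn|].
  apply two_minus_two_cos. apply Rmult_le_pos; lra.
Qed.

(** The source of the gain of two powers of [h]: differencing twice in the frequency multiplies the
    integrand by [2 - 2 * cos s], which is at most [s ^ 2]. *)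
Lemma tent_kernel_product (n : nat) (s : R) :
  2 * cos (INR (S n) * s) - cos (INR (S (S n)) * s) - cos (INR n * s)
  = (2 - 2 * cos s) * cos (INR (S n) * s).
Proof.
  replace (INR (S (S n)) * s) with (INR (S n) * s + s)
    by (rewrite (S_INR (S n)); ring).
  replace (INR n * s) with (INR (S n) * s - s) by (rewrite S_INR; ring).
  rewrite cos_plus, cos_minus. ring.
Qed.

Lemma is_derive_tent_primitive_diff2 (h : R) (n : nat) (s : R) :
  is_derive (fun s => 2 * (2 * tent_primitive h (S n) s
      - tent_primitive h (S (S n)) s - tent_primitive h n s)) s
    (2 * ((h - s) * (2 - 2 * cos s) * cos (INR (S n) * s))).
Proof.
  rewrite Rmult_assoc, <- tent_kernel_product.
  pose proof (is_derive_tent_primitive h n s) as H0.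
  pose proof (is_derive_tent_primitive h (S n) s) as H1.
  pose proof (is_derive_tent_primitive h (S (S n)) s) as H2.
  set (T0 := tent_primitive h n) in *. set (T1 := tent_primitive h (S n)) in *.
  set (T2 := tent_primitive h (S (S n))) in *.
  evar_last.
  - apply (is_derive_scal (fun s => 2 * T1 s - T2 s - T0 s)).
    apply (is_derive_minus (V := R_NormedModule) (fun s => 2 * T1 s - T2 s));
      [|exact H0].
    apply (is_derive_minus (V := R_NormedModule) (fun s => 2 * T1 s));
      [|exact H2].
    apply is_derive_scal, H1.
  - unfold minus, plus, opp; simpl. ring.
Qed.

Lemma riemann_coef_diff2_increment (h : R) (n : nat) :
  riemann_coef_diff2 h (S n) =
  2 * (2 * tent_primitive h (S n) h
      - tent_primitive h (S (S n)) h - tent_primitive h n h)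
  - 2 * (2 * tent_primitive h (S n) 0
      - tent_primitive h (S (S n)) 0 - tent_primitive h n 0).
Proof.
  unfold riemann_coef_diff2. rewrite <- !tent_primitive_increment.
  change (Nat.pred (S n)) with n. ring.
Qed.

Lemma Rabs_cos_le (x : R) : Rabs (cos x) <= 1.
Proof. apply Rabs_le, COS_bound. Qed.

(** The integrand is at most [2 * h * h ^ 2] on an interval of length [h]. This bound serves the
    frequencies up to about [1 / h]. *)
Lemma riemann_coef_diff2_le_pow4 (h : R) (n : nat) :
  0 <= h -> Rabs (riemann_coef_diff2 h (S n)) <= 2 * h ^ 4.
Proof.
  intros Hh. rewrite riemann_coef_diff2_increment.
  replace (2 * h ^ 4) with (2 * h ^ 3 * h) by ring.
  apply (increment_bound (fun s => 2 * (2 * tent_primitive h (S n) s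
      - tent_primitive h (S (S n)) s - tent_primitive h n s))
    (fun s => 2 * ((h - s) * (2 - 2 * cos s) * cos (INR (S n) * s)))).
  - exact Hh.
  - intros s _. apply is_derive_tent_primitive_diff2.
  - intros s Hs. destruct (two_minus_two_cos s) as [[H1 H2] _]; [lra|].
    rewrite !Rabs_mult, (Rabs_pos_eq 2), (Rabs_pos_eq (h - s)),
      (Rabs_pos_eq (2 - 2 * cos s)) by lra.
    replace (2 * h ^ 3) with (2 * (h * h ^ 2 * 1)) by ring.
    apply Rmult_le_compat_l; [lra|].
    apply Rmult_le_compat; [apply Rmult_le_pos; lra|apply Rabs_pos| |
      apply Rabs_cos_le].
    apply Rmult_le_compat; [lra|lra|lra|].
    apply Rle_trans with (s ^ 2); [exact H2|]. apply pow_incr; lra.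
Qed.

(* Two integrations by parts of
   [2 (h - s) (2 - 2 cos s) cos (n s)] over [0 <= s <= h]. *)
Lemma riemann_coef_diff2_le_inv_sqr (h : R) (n : nat) :
  0 <= h ->
  Rabs (riemann_coef_diff2 h (S n)) <= 14 * h ^ 2 / INR (S n) ^ 2.
Proof.
  intros Hh. rewrite riemann_coef_diff2_increment.
  set (K := fun s => 2 * (2 * tent_primitive h (S n) s
      - tent_primitive h (S (S n)) s - tent_primitive h n s)).
  change (Rabs (K h - K 0) <= 14 * h ^ 2 / INR (S n) ^ 2).
  assert (HN : 0 < INR (S n)) by (apply lt_0_INR; lia).
  pose proof (fun s => is_derive_tent_primitive_diff2 h n s) as HK.
  change (forall s, is_derive K s
    (2 * ((h - s) * (2 - 2 * cos s) * cos (INR (S n) * s)))) in HK.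
  set (N := INR (S n)) in *. clearbody N K.
  (* [q'] and [q''] are the derivatives of the amplitude [(h - s) * (2 - 2 * cos s)], and [J]
     collects the boundary terms of both integrations by parts. The constant 14 is 12 from
     [Rabs (q'' s) <= 6 * h], plus 2 from the only surviving boundary value,
     [q' h = - (2 - 2 * cos h)]. *)
  set (q' := fun s => 2 * (h - s) * sin s - (2 - 2 * cos s)).
  set (q'' := fun s => 2 * (h - s) * cos s - 4 * sin s).
  set (J := fun s => 2 * ((h - s) * (2 - 2 * cos s) * sin (N * s) / N
                        + q' s * cos (N * s) / N ^ 2)).
  assert (HM : Rabs ((fun s => K s - J s) h - (fun s => K s - J s) 0)
    <= 12 * h / N ^ 2 * h).
  { apply (increment_bound (fun s => K s - J s)
      (fun s => - 2 * q'' s * cos (N * s) / N ^ 2)); [exact Hh| |].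
    - intros s Hs. evar_last.
      + apply (is_derive_minus (V := R_NormedModule) K J); [apply HK|].
        unfold J, q'. auto_derive; [trivial|reflexivity].
      + unfold minus, plus, opp, q''; simpl. field. lra.
    - intros s Hs.
      assert (Hq : Rabs (q'' s) <= 6 * h).
      { unfold q''. eapply Rle_trans; [apply Rabs_triang|].
        rewrite Rabs_Ropp, !Rabs_mult, (Rabs_pos_eq 2), (Rabs_pos_eq 4),
          (Rabs_pos_eq (h - s)) by lra.
        assert ((h - s) * Rabs (cos s) <= (h - s) * 1).
        { apply Rmult_le_compat_l; [lra|apply Rabs_cos_le]. }
        pose proof (Rabs_sin_le s ltac:(lra)). lra. }
      unfold Rdiv. rewrite Rabs_mult.
      rewrite (Rabs_pos_eq (/ N ^ 2))
        by (left; apply Rinv_0_lt_compat, pow_lt, HN).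
      apply Rmult_le_compat_r; [left; apply Rinv_0_lt_compat, pow_lt, HN|].
      rewrite !Rabs_mult.
      replace (Rabs (-2)) with 2 by (rewrite Rabs_left; lra).
      replace (12 * h) with (2 * (6 * h) * 1) by ring.
      apply Rmult_le_compat;
        [apply Rmult_le_pos; [lra|apply Rabs_pos]|apply Rabs_pos| |
         apply Rabs_cos_le].
      apply Rmult_le_compat_l; lra. }
  assert (HJ : J h - J 0 = - 2 * ((2 - 2 * cos h) * cos (N * h)) / N ^ 2).
  { unfold J, q'. rewrite !Rmult_0_r, sin_0, cos_0. field. lra. }
  assert (HJ' : Rabs (J h - J 0) <= 2 * h ^ 2 / N ^ 2).
  { rewrite HJ. destruct (two_minus_two_cos h Hh) as [[H1 H2] _].
    unfold Rdiv. rewrite Rabs_mult.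
    rewrite (Rabs_pos_eq (/ N ^ 2))
      by (left; apply Rinv_0_lt_compat, pow_lt, HN).
    apply Rmult_le_compat_r; [left; apply Rinv_0_lt_compat, pow_lt, HN|].
    rewrite !Rabs_mult, (Rabs_pos_eq (2 - 2 * cos h)) by lra.
    replace (Rabs (-2)) with 2 by (rewrite Rabs_left; lra).
    rewrite <- (Rmult_1_r (h ^ 2)).
    apply Rmult_le_compat_l; [lra|].
    apply Rmult_le_compat; [lra|apply Rabs_pos|exact H2|apply Rabs_cos_le]. }
  replace (K h - K 0) with ((K h - J h - (K 0 - J 0)) + (J h - J 0)) by ring.
  eapply Rle_trans; [apply Rabs_triang|].
  replace (14 * h ^ 2 / N ^ 2) with (12 * h / N ^ 2 * h + 2 * h ^ 2 / N ^ 2)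
    by (field; lra).
  cbv beta in HM. lra.
Qed.

(** A summable majorant of total mass at most 1 for every [h]. For small [h] it has the order of the
    smaller of [h] and [1 / (h * (k + 1) ^ 2)], so it handles the ranges of low and high frequencies
    at once. *)
Definition telescope (h : R) (k : nat) : R :=
  / (1 + INR k * h) - / (1 + INR (S k) * h).

Lemma telescope_sum_le (h : R) (N : nat) :
  0 <= h -> sum_n (telescope h) N <= 1.
Proof.
  intros Hh. assert (E : sum_n (telescope h) N = 1 - / (1 + INR (S N) * h)).
  { induction N as [|N IH].
    - rewrite sum_O. unfold telescope.
      change (INR 0) with 0. rewrite Rmult_0_l, Rplus_0_r, Rinv_1. reflexivity.
    - rewrite sum_Sn, IH. unfold telescope, plus; simpl plus. simpl. ring. }
  rewrite E. assert (0 <= INR (S N) * h) by (apply Rmult_le_pos; [apply pos_INR|lra]).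
  assert (0 < / (1 + INR (S N) * h)) by (apply Rinv_0_lt_compat; lra). lra.
Qed.

(** The two bounds on [v] cross at [n * h = 2], where [n = k + 1]. Below it
    [(1 + n * h) ^ 2 <= 3 ^ 2]; above it [1 + n * h <= 3 / 2 * (n * h)]. Both cases give the
    constant 9. *)
Lemma le_telescope (h v : R) (k : nat) :
  0 <= h -> v <= h ^ 2 -> v <= 4 / INR (S k) ^ 2 -> v <= 9 * h * telescope h k.
Proof.
  intros Hh H1 H2. unfold telescope.
  assert (HN : 0 < INR (S k)) by (apply lt_0_INR; lia).
  assert (Hk : 0 <= INR k) by apply pos_INR.
  rewrite S_INR in *. set (x := INR k) in *. clearbody x.
  assert (Hx : 0 <= x * h) by (apply Rmult_le_pos; lra).
  assert (Hx' : 0 <= (x + 1) * h) by (apply Rmult_le_pos; lra).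
  replace (9 * h * _) with (9 * h ^ 2 / ((1 + x * h) * (1 + (x + 1) * h)))
    by (field; lra).
  apply Rle_div_r; [apply Rmult_lt_0_compat; lra|].
  destruct (Rle_lt_dec v 0) as [Hv|Hv].
  { apply Rle_trans with 0; [|pose proof (pow2_ge_0 h); lra].
    rewrite <- (Rmult_0_l ((1 + x * h) * (1 + (x + 1) * h))).
    apply Rmult_le_compat_r; [apply Rmult_le_pos; lra|exact Hv]. }
  apply Rle_trans with (v * (1 + (x + 1) * h) ^ 2).
  { apply Rmult_le_compat_l; [lra|]. simpl. rewrite Rmult_1_r.
    apply Rmult_le_compat_r; lra. }
  destruct (Rle_lt_dec ((x + 1) * h) 2) as [H|H].
  - apply Rle_trans with (h ^ 2 * 3 ^ 2); [|lra].
    apply Rmult_le_compat; [lra|apply pow2_ge_0|exact H1|].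
    apply pow_incr; lra.
  - apply Rle_trans with (4 / (x + 1) ^ 2 * (3 / 2 * ((x + 1) * h)) ^ 2).
    + apply Rmult_le_compat; [lra|apply pow2_ge_0|exact H2|].
      apply pow_incr; lra.
    + right. field. lra.
Qed.

Lemma riemann_coef_le_telescope (h : R) (k : nat) :
  0 <= h -> riemann_coef h (S k) <= 9 * h * telescope h k.
Proof.
  intros Hh. apply le_telescope; [exact Hh|now apply riemann_coef_le_sqr|].
  now apply riemann_coef_le_inv_sqr.
Qed.

(** After division by [14 * h ^ 2] the two bounds on the second difference satisfy the hypotheses of
    [le_telescope]; hence 126 = 9 * 14. Summed over [k], this is the O(h^3) behind the estimate at
    regular points. *)
Lemma riemann_coef_diff2_le_telescope (h : R) (k : nat) :
  0 < h -> Rabs (riemann_coef_diff2 h (S k)) <= 126 * h ^ 3 * telescope h k.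
Proof.
  intros Hh. assert (H2 : 0 < h ^ 2) by now apply pow_lt.
  assert (HN : 0 < INR (S k)) by (apply lt_0_INR; lia).
  assert (H4 : 0 < h ^ 4) by now apply pow_lt.
  pose proof (riemann_coef_diff2_le_pow4 h k ltac:(lra)) as B1.
  pose proof (riemann_coef_diff2_le_inv_sqr h k ltac:(lra)) as B2.
  replace (126 * h ^ 3 * telescope h k)
    with ((9 * h * telescope h k) * (14 * h ^ 2)) by ring.
  apply Rle_div_l; [lra|]. apply le_telescope; [lra| |].
  - apply Rle_div_l; [lra|]. replace (h ^ 2 * (14 * h ^ 2)) with (14 * h ^ 4) by ring.
    lra.
  - apply Rle_div_l; [lra|]. eapply Rle_trans; [exact B2|].
    replace (4 / INR (S k) ^ 2 * (14 * h ^ 2))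
      with (4 * (14 * h ^ 2 / INR (S k) ^ 2)) by (field; lra).
    assert (0 < 14 * h ^ 2 / INR (S k) ^ 2).
    { apply Rdiv_lt_0_compat; [lra|now apply pow_lt]. }
    lra.
Qed.

Lemma riemann_coef_diff2_0 (h : R) :
  0 <= h -> Rabs (riemann_coef_diff2 h 0) <= h ^ 4.
Proof.
  intros Hh. unfold riemann_coef_diff2. simpl Nat.pred.
  rewrite <- !tent_primitive_increment.
  pose proof (fun s => is_derive_tent_primitive h 0 s) as H0.
  pose proof (fun s => is_derive_tent_primitive h 1 s) as H1.
  set (T0 := tent_primitive h 0) in *. set (T1 := tent_primitive h 1) in *.
  replace (2 * (2 * (T0 h - T0 0)) - 2 * (T1 h - T1 0) - 2 * (T0 h - T0 0))
    with ((fun s => 2 * T0 s - 2 * T1 s) h - (fun s => 2 * T0 s - 2 * T1 s) 0)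
    by (cbv beta; ring).
  replace (h ^ 4) with (h * h ^ 2 * h) by ring.
  apply (increment_bound (fun s => 2 * T0 s - 2 * T1 s)
    (fun s => (h - s) * (2 - 2 * cos s))); [exact Hh| |].
  - intros s _. evar_last.
    + apply (is_derive_minus (V := R_NormedModule)
        (fun s => 2 * T0 s) (fun s => 2 * T1 s)); apply is_derive_scal;
        [apply H0|apply H1].
    + unfold minus, plus, opp; simpl.
      rewrite Rmult_0_l, Rmult_1_l, cos_0. ring.
  - intros s Hs. destruct (two_minus_two_cos s) as [[B1 B2] _]; [lra|].
    rewrite Rabs_mult, !Rabs_pos_eq by lra.
    apply Rmult_le_compat; [lra|lra|lra|].
    apply Rle_trans with (s ^ 2); [exact B2|]. apply pow_incr; lra.
Qed.

(** * Linear identities in complex vector spaces *)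

(** Reified linear combinations over a list of atoms. Only the vector structure is reified: scalars
    stay as they are, so that the resulting equations between coefficients can be left to [ring] or
    [field] in [C]. *)
Inductive mexp : Type :=
  | MVar (i : nat) | MZero | MPlus (e f : mexp) | MOpp (e : mexp)
  | MScal (k : C) (e : mexp).

Fixpoint mcoef (e : mexp) (i : nat) : C :=
  match e with
  | MVar j => if Nat.eqb i j then RtoC 1 else RtoC 0
  | MZero => RtoC 0
  | MPlus e f => (mcoef e i + mcoef f i)%C
  | MOpp e => (- mcoef e i)%C
  | MScal k e => (k * mcoef e i)%C
  end.

Section ModuleSolver.
Context {V : ModuleSpace C_AbsRing}.

Fixpoint mlin (f : nat -> C) (env : list V) : V :=
  match env with
  | nil => zero
  | v :: env => plus (scal (f O) v) (mlin (fun i => f (S i)) env)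
  end.

Fixpoint meval (env : list V) (e : mexp) : V :=
  match e with
  | MVar i => nth i env zero
  | MZero => zero
  | MPlus e f => plus (meval env e) (meval env f)
  | MOpp e => opp (meval env e)
  | MScal k e => scal (k : C_AbsRing) (meval env e)
  end.

Lemma mlin_ext (f g : nat -> C) (env : list V) :
  (forall i, f i = g i) -> mlin f env = mlin g env.
Proof.
  revert f g; induction env as [|v env IH]; intros f g H; [reflexivity|].
  cbn [mlin]. rewrite H. f_equal. now apply IH.
Qed.

Lemma mlin_zero (env : list V) : mlin (fun _ => RtoC 0) env = zero.
Proof.
  induction env as [|v env IH]; [reflexivity|]. cbn [mlin]. rewrite IH.
  rewrite plus_zero_r. apply (scal_zero_l (K := C_AbsRing)).
Qed.

Lemma mlin_plus (f g : nat -> C) (env : list V) :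
  mlin (fun i => f i + g i)%C env = plus (mlin f env) (mlin g env).
Proof.
  revert f g; induction env as [|v env IH]; intros f g; cbn [mlin].
  - now rewrite plus_zero_r.
  - rewrite (IH (fun i => f (S i)) (fun i => g (S i))).
    eapply eq_trans;
      [apply f_equal2; [exact (scal_distr_r (f O : C_AbsRing) (g O) v)
                       |reflexivity]|].
    rewrite <- !plus_assoc. f_equal. rewrite !plus_assoc. f_equal.
    apply plus_comm.
Qed.

Lemma mlin_scal (k : C_AbsRing) (f : nat -> C) (env : list V) :
  mlin (fun i => (k : C) * f i)%C env = scal k (mlin f env).
Proof.
  revert f; induction env as [|v env IH]; intros f; cbn [mlin].
  - now rewrite scal_zero_r.
  - rewrite (IH (fun i => f (S i))), scal_distr_l. f_equal.
    symmetry. exact (scal_assoc k (f O : C_AbsRing) v).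
Qed.

Lemma mlin_var (j : nat) (env : list V) :
  mlin (fun i => if Nat.eqb i j then RtoC 1 else RtoC 0) env = nth j env zero.
Proof.
  revert j; induction env as [|v env IH]; intros [|j]; cbn [mlin nth];
    try reflexivity.
  - cbn [Nat.eqb]. rewrite mlin_zero, plus_zero_r.
    exact (scal_one (K := C_AbsRing) v).
  - cbn [Nat.eqb]. rewrite IH.
    eapply eq_trans; [|apply plus_zero_l]. f_equal.
    apply (scal_zero_l (K := C_AbsRing)).
Qed.

Lemma meval_mlin (env : list V) (e : mexp) :
  meval env e = mlin (mcoef e) env.
Proof.
  induction e as [i| |e IHe f IHf|e IHe|k e IHe]; cbn [meval mcoef].
  - symmetry. apply mlin_var.
  - symmetry. apply mlin_zero.
  - rewrite IHe, IHf. symmetry. apply mlin_plus.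
  - rewrite IHe, <- scal_opp_one.
    rewrite <- (mlin_scal (opp one) (mcoef e)). apply mlin_ext. intros i.
    unfold opp, one; simpl. ring.
  - rewrite IHe. symmetry. apply mlin_scal.
Qed.

Fixpoint mcoef_eq (n : nat) (f g : nat -> C) : Prop :=
  match n with
  | O => True
  | S n => f O = g O /\ mcoef_eq n (fun i => f (S i)) (fun i => g (S i))
  end.

Lemma meval_eq (env : list V) (e f : mexp) :
  mcoef_eq (length env) (mcoef e) (mcoef f) -> meval env e = meval env f.
Proof.
  rewrite !meval_mlin. generalize (mcoef e) (mcoef f).
  induction env as [|v env IH]; intros p q; [reflexivity|].
  intros [H1 H2]. cbn [mlin]. rewrite H1. f_equal. now apply IH.
Qed.
End ModuleSolver.

Ltac mod_index v env :=
  match env with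
  | v :: _ => constr:(O)
  | _ :: ?t => let i := mod_index v t in constr:(S i)
  end.
Ltac mod_add v env :=
  match constr:(tt) with
  | _ => let i := mod_index v env in env
  | _ => constr:(v :: env)
  end.
Ltac mod_atoms t env :=
  lazymatch t with
  | plus ?a ?b => let env := mod_atoms a env in mod_atoms b env
  | minus ?a ?b => let env := mod_atoms a env in mod_atoms b env
  | opp ?a => mod_atoms a env
  | scal _ ?a => mod_atoms a env
  | zero => env
  | _ => mod_add t env
  end.
Ltac mod_reify t env :=
  lazymatch t with
  | plus ?a ?b => let a := mod_reify a env in let b := mod_reify b env in
      constr:(MPlus a b)
  | minus ?a ?b => let a := mod_reify a env in let b := mod_reify b env in
      constr:(MPlus a (MOpp b))
  | opp ?a => let a := mod_reify a env in constr:(MOpp a)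
  | scal ?k ?a => let a := mod_reify a env in constr:(MScal k a)
  | zero => constr:(MZero)
  | _ => let i := mod_index t env in constr:(MVar i)
  end.
(* Reduces an equality of linear combinations in a complex vector space to the
   equalities of the coefficients of each atom. *)
Ltac module_eq :=
  lazymatch goal with
  | |- @eq ?T ?a ?b =>
    let env := mod_atoms a (@nil T) in
    let env := mod_atoms b env in
    let ea := mod_reify a env in
    let eb := mod_reify b env in
    refine (meval_eq env ea eb _);
    cbn [mcoef_eq length mcoef Nat.eqb]; repeat split
  end.
Ltac module_ring := module_eq; ring.

(** * Series in normed modules *)

Lemma minus_plus_l (G : AbelianGroup) (u v : G) :
  minus u (plus u v) = opp v.
Proof.
  rewrite minus_unfold, opp_plus, plus_assoc, plus_opp_r. apply plus_zero_l.
Qed.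

Section Series.
Context {K : AbsRing} {V : NormedModule K}.

Lemma is_series_norm (a : nat -> V) (l : V) :
  is_series a l <->
  forall e, 0 < e -> exists N, forall n, (N <= n)%nat ->
    norm (minus (sum_n a n) l) < e.
Proof.
  unfold is_series. split.
  - intros H e He.
    destruct (proj1 (filterlim_locally_ball_norm (sum_n a) l) H (mkposreal e He))
      as [N HN].
    exists N. exact HN.
  - intros H. apply (filterlim_locally_ball_norm (sum_n a) l). intros e.
    destruct (H e (cond_pos e)) as [N HN]. exists N. exact HN.
Qed.

Lemma is_series_unique_vec (a : nat -> V) (l l' : V) :
  is_series a l -> is_series a l' -> l = l'.
Proof. apply filterlim_locally_unique. Qed.

Lemma norm_le_plus_minus (u v : V) : norm u <= norm v + norm (minus v u).
Proof.
  assert (E : plus v (opp (minus v u)) = u) by exact (plus_opp_minus v u).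
  rewrite <- E at 1. eapply Rle_trans; [apply norm_triangle|].
  rewrite norm_opp. lra.
Qed.

Lemma norm_minus_self (u : V) : norm (minus u u) = 0.
Proof.
  assert (E : minus u u = (zero : V)) by exact (minus_eq_zero u).
  rewrite E. apply norm_zero.
Qed.

Lemma norm_minus_plus_l (u v : V) : norm (minus u (plus u v)) = norm v.
Proof.
  assert (E : minus u (plus u v) = (opp v : V)) by exact (minus_plus_l V u v).
  rewrite E. apply norm_opp.
Qed.

(** Meant for summation by parts: [c] is the term of frequency zero, kept outside the series, and
    [d n] bounds the boundary terms at the upper end, which disappear in the limit. *)
Lemma norm_series_le_lim (a : nat -> V) (c l : V) (B : R) (d : nat -> R) :
  is_series a l -> (forall n, norm (plus c (sum_n a n)) <= B + d n) ->
  is_lim_seq d 0 -> norm (plus c l) <= B.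
Proof.
  intros Ha HB Hd. apply le_epsilon. intros e He.
  destruct (proj1 (is_series_norm a l) Ha (e / 2)) as [N HN]; [lra|].
  destruct (proj1 (filterlim_locally d 0) Hd (mkposreal (e / 2) ltac:(lra)))
    as [N' HN'].
  specialize (HN (max N N') ltac:(lia)). specialize (HN' (max N N') ltac:(lia)).
  assert (H : Rabs (d (max N N') - 0) < e / 2) by exact HN'.
  apply Rabs_lt_between in H.
  specialize (HB (max N N')).
  pose proof (norm_le_plus_minus (plus c l) (plus c (sum_n a (max N N')))) as H'.
  assert (E : minus (plus c (sum_n a (max N N'))) (plus c l)
    = minus (sum_n a (max N N')) l).
  { eapply eq_trans; [exact (minus_plus_plus _ _ _ _)|].
    eapply eq_trans; [apply f_equal2; [exact (minus_eq_zero c)|reflexivity]|].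
    apply plus_zero_l. }
  rewrite E in H'. lra.
Qed.

Lemma norm_series_le (a : nat -> V) (l : V) (B : R) :
  is_series a l -> (forall n, norm (sum_n a n) <= B) -> norm l <= B.
Proof.
  intros Ha HB. rewrite <- (plus_zero_l l).
  apply (norm_series_le_lim a zero l B (fun _ => 0)); [exact Ha| |].
  - intros n. rewrite plus_zero_l, Rplus_0_r. apply HB.
  - apply is_lim_seq_const.
Qed.

Lemma norm_sum_n_le (a : nat -> V) (b : nat -> R) (n : nat) :
  (forall k, norm (a k) <= b k) -> norm (sum_n a n) <= sum_n b n.
Proof.
  intros H. induction n as [|n IH]; [rewrite !sum_O; apply H|].
  rewrite !sum_Sn. eapply Rle_trans; [apply norm_triangle|].
  now apply Rplus_le_compat.
Qed.

Lemma sum_n_le_series (b : nat -> R) (S : R) (n : nat) :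
  (forall k, 0 <= b k) -> is_series b S -> sum_n b n <= S.
Proof.
  intros Hb HS. apply (is_lim_seq_incr_compare (sum_n b)); [exact HS|].
  intros k. rewrite sum_Sn. specialize (Hb (Datatypes.S k)).
  unfold plus; simpl. lra.
Qed.

Lemma norm_series_tail_le (a : nat -> V) (b : nat -> R) (l : V) (S : R) n :
  (forall k, norm (a k) <= b k) -> is_series a l -> is_series b S ->
  norm (minus (sum_n a n) l) <= S - sum_n b n.
Proof.
  intros Hab Ha Hb.
  assert (Hb0 : forall k, 0 <= b k).
  { intros k. exact (Rle_trans _ _ _ (norm_ge_0 (a k)) (Hab k)). }
  assert (Hk : forall k, norm (minus (sum_n a n) (sum_n a (n + k)%nat))
    <= sum_n b (n + k)%nat - sum_n b n).
  { induction k as [|k IH].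
    - rewrite Nat.add_0_r, norm_minus_self. lra.
    - rewrite Nat.add_succ_r, !sum_Sn.
      rewrite (minus_trans (sum_n a (n + k)%nat)).
      eapply Rle_trans; [apply norm_triangle|].
      rewrite norm_minus_plus_l. specialize (Hab (Datatypes.S (n + k))).
      unfold plus at 1; simpl. lra. }
  apply le_epsilon. intros e He.
  destruct (proj1 (is_series_norm a l) Ha e He) as [N HN].
  specialize (HN (n + N)%nat ltac:(lia)). specialize (Hk N).
  pose proof (sum_n_le_series b S (n + N)%nat Hb0 Hb).
  rewrite (minus_trans (sum_n a (n + N)%nat)).
  eapply Rle_trans; [apply norm_triangle|]. lra.
Qed.
End Series.

(** Completeness expressed by dominated series. In this form it passes to quotients by lifting the
    terms one at a time, and it applies directly to Neumann series and to Riemann's function. *)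
Definition abs_complete {K : AbsRing} (V : NormedModule K) : Prop :=
  forall (a : nat -> V) (b : nat -> R),
    (forall n, norm (a n) <= b n) -> ex_series b -> ex_series a.

Lemma is_series_dominated (K : AbsRing) (V : NormedModule K) (a : nat -> V)
  (l : V) (b : nat -> R) (S : R) :
  is_series b S ->
  (forall n, norm (minus (sum_n a n) l) <= S - sum_n b n) -> is_series a l.
Proof.
  intros Hb H. apply is_series_norm. intros e He.
  destruct (proj1 (is_series_norm (V := R_NormedModule) b S) Hb e He)
    as [N HN].
  exists N. intros n Hn. specialize (HN n Hn).
  eapply Rle_lt_trans; [apply H|].
  assert (E : Rabs (sum_n b n - S) < e) by exact HN.
  apply Rabs_lt_between in E. lra.
Qed.

Lemma linf_sum_n (K : AbsRing) (X : NormedModule K) (a : nat -> linf X) n m :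
  sum_n a n m = sum_n (fun k => a k m) n.
Proof.
  induction n as [|n IH]; [now rewrite !sum_O|]. rewrite !sum_Sn, <- IH.
  reflexivity.
Qed.

(** The series is summed at each index [m] separately; the tail bound [S - sum_n b n] does not
    depend on [m], so the convergence is uniform. *)
Lemma linf_abs_complete (K : AbsRing) (X : CompleteNormedModule K) :
  abs_complete (linf_NormedModule X).
Proof.
  intros a b Hab [S HS].
  assert (Hm : forall m n, norm (a n m) <= b n).
  { intros m n. eapply Rle_trans; [apply sup_norm_ge|apply Hab]. }
  assert (Hb0 : forall n, 0 <= b n).
  { intros n. exact (Rle_trans _ _ _ (norm_ge_0 (a n)) (Hab n)). }
  assert (Hex : forall m, exists l : X, is_series (fun n => a n m) l).
  { intros m. apply (ex_series_le _ b); [apply Hm|now exists S]. }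
  set (s := fun m => proj1_sig (constructive_indefinite_description _ (Hex m))).
  assert (Hs : forall m, is_series (fun n => a n m) (s m)).
  { intros m. exact (proj2_sig (constructive_indefinite_description _ (Hex m))). }
  assert (Bs : bounded_seq s).
  { exists S. intros m. eapply norm_series_le; [apply Hs|]. intros n.
    eapply Rle_trans; [apply norm_sum_n_le, Hm|].
    now apply sum_n_le_series. }
  exists (Linf Bs). apply is_series_dominated with b S; [exact HS|].
  intros n. apply (sup_norm_le (x := minus (sum_n a n) (Linf Bs))). intros m.
  change (norm (minus (sum_n a n m) (s m)) <= S - sum_n b n).
  rewrite linf_sum_n. now apply norm_series_tail_le.
Qed.

(** Each term is lifted to a representative whose norm exceeds the quotient norm by less than
    [(1 / 2) ^ n]. The lifted series is still dominated, and the projection is contractive. *)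
Lemma quot_abs_complete (K : AbsRing) (V : NormedModule K)
  (W : closed_subspace V) :
  abs_complete V -> abs_complete (quot_NormedModule W).
Proof.
  intros HV a b Hab Hb.
  assert (Hex : forall n, exists v : V,
    quot_proj W v = a n /\ norm v < quot_norm (a n) + (1 / 2) ^ n).
  { intros n. apply quot_norm_approx, pow_lt. lra. }
  set (v := fun n => proj1_sig (constructive_indefinite_description _ (Hex n))).
  assert (Hv : forall n, quot_proj W (v n) = a n /\
    norm (v n) < quot_norm (a n) + (1 / 2) ^ n).
  { intros n.
    exact (proj2_sig (constructive_indefinite_description _ (Hex n))). }
  destruct (HV v (fun n => plus (b n) ((1 / 2) ^ n))) as [s Hs].
  - intros n. destruct (Hv n) as [_ H]. specialize (Hab n).
    change (quot_norm (a n) <= b n) in Hab. unfold plus; simpl. lra.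
  - apply (ex_series_plus (V := R_NormedModule)); [exact Hb|].
    apply ex_series_geom. rewrite Rabs_pos_eq; lra.
  - exists (quot_proj W s). apply is_series_norm. intros e He.
    destruct (proj1 (is_series_norm v s) Hs e He) as [N HN].
    exists N. intros n Hn.
    assert (E : sum_n a n = quot_proj W (sum_n v n)).
    { clear Hn. induction n as [|n IH].
      - rewrite !sum_O. symmetry. apply Hv.
      - rewrite !sum_Sn, IH. destruct (Hv (S n)) as [<- _].
        exact (quot_proj_plus W _ _). }
    rewrite E.
    assert (E' : minus (quot_proj W (sum_n v n) : quot_NormedModule W)
      (quot_proj W s) = quot_proj W (minus (sum_n v n) s)).
    { change (quot_plus (quot_proj W (sum_n v n)) (quot_opp (quot_proj W s))
        = quot_proj W (minus (sum_n v n) s)).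
      now rewrite quot_proj_opp, quot_proj_plus. }
    rewrite E'. eapply Rle_lt_trans; [apply quot_norm_le|]. now apply HN.
Qed.

(** * Neumann series and the resolvent *)

(** Unlike [is_linear], this displays the bound: everything depends on the shift and its inverse
    having constant 1, and Neumann series on a constant below 1. *)
Record lipschitz_linear {Y : NormedModule C_AbsRing} (q : R) (T : Y -> Y) :
  Prop := {
  ll_plus : forall u v, T (plus u v) = plus (T u) (T v);
  ll_scal : forall (k : C) u, T (scal (k : C_AbsRing) u) = scal (k : C_AbsRing) (T u);
  ll_norm : forall u, norm (T u) <= q * norm u
}.

Section Neumann.
Context {Y : NormedModule C_AbsRing}.
Hypothesis Ycomplete : abs_complete Y.

Lemma ll_minus (q : R) (T : Y -> Y) (u v : Y) :
  lipschitz_linear q T -> T (minus u v) = minus (T u) (T v).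
Proof.
  intros HT. replace (minus u v) with (plus u (scal (RtoC (-1) : C_AbsRing) v))
    by (module_eq; apply injective_projections; simpl; ring).
  rewrite (ll_plus _ _ HT), (ll_scal _ _ HT).
  module_eq; apply injective_projections; simpl; ring.
Qed.

Lemma norm_iter_le (q : R) (T : Y -> Y) (n : nat) (v : Y) :
  0 <= q -> lipschitz_linear q T -> norm (Nat.iter n T v) <= q ^ n * norm v.
Proof.
  intros Hq HT. induction n as [|n IH]; [simpl; lra|].
  change (norm (T (Nat.iter n T v)) <= q ^ S n * norm v).
  eapply Rle_trans; [apply (ll_norm _ _ HT)|]. simpl. rewrite Rmult_assoc.
  now apply Rmult_le_compat_l.
Qed.

Lemma ll_series (q : R) (T : Y -> Y) (a : nat -> Y) (l : Y) :
  0 <= q -> lipschitz_linear q T ->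
  is_series a l -> is_series (fun n => T (a n)) (T l).
Proof.
  intros Hq HT Ha. apply is_series_norm. intros e He.
  destruct (proj1 (is_series_norm a l) Ha (e / (q + 1))) as [N HN].
  { apply Rdiv_lt_0_compat; lra. }
  exists N. intros n Hn. specialize (HN n Hn).
  assert (E : sum_n (fun n => T (a n)) n = T (sum_n a n)).
  { clear Hn HN. induction n as [|n IH]; [now rewrite !sum_O|].
    now rewrite !sum_Sn, IH, (ll_plus _ _ HT). }
  rewrite E, <- (ll_minus _ _ _ _ HT).
  eapply Rle_lt_trans; [apply (ll_norm _ _ HT)|].
  apply Rlt_div_r in HN; [|lra].
  pose proof (norm_ge_0 (minus (sum_n a n) l)). lra.
Qed.

Lemma ll_iter (q : R) (T : Y -> Y) (n : nat) :
  lipschitz_linear q T ->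
  (forall u v, Nat.iter n T (plus u v) = plus (Nat.iter n T u) (Nat.iter n T v)) /\
  (forall (k : C) u, Nat.iter n T (scal (k : C_AbsRing) u)
    = scal (k : C_AbsRing) (Nat.iter n T u)).
Proof.
  intros HT. induction n as [|n [IH1 IH2]]; [now split|]. simpl. split; intros.
  - now rewrite IH1, (ll_plus _ _ HT).
  - now rewrite IH2, (ll_scal _ _ HT).
Qed.

(** [N] is the sum of the powers of [P]. Removing the first term and factoring [P] out on either
    side gives two equations, which later yield a right and a left inverse. *)
Lemma neumann_series (q : R) (P : Y -> Y) :
  0 <= q < 1 -> lipschitz_linear q P ->
  exists N : Y -> Y, lipschitz_linear (/ (1 - q)) N /\
    (forall v, N v = plus v (P (N v))) /\ (forall v, N v = plus v (N (P v))).
Proof.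
  intros Hq HP.
  assert (Hgeom : is_series (fun n => q ^ n) (/ (1 - q))).
  { apply is_series_geom. rewrite Rabs_pos_eq; lra. }
  assert (Hex : forall v, exists l, is_series (fun n => Nat.iter n P v) l).
  { intros v. apply (Ycomplete _ (fun n => scal (norm v) (q ^ n))).
    - intros n. unfold scal; simpl. unfold mult; simpl. rewrite Rmult_comm.
      now apply norm_iter_le.
    - apply (ex_series_scal (V := R_NormedModule)). eexists; exact Hgeom. }
  set (N := fun v => proj1_sig (constructive_indefinite_description _ (Hex v))).
  assert (HN : forall v, is_series (fun n => Nat.iter n P v) (N v)).
  { intros v. exact (proj2_sig (constructive_indefinite_description _ (Hex v))). }
  assert (Hshift : forall v, is_series (fun n => Nat.iter (S n) P v) (minus (N v) v)).
  { intros v. apply (is_series_incr_1 (fun n => Nat.iter n P v)).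
    assert (E : N v = plus (minus (N v) v) v) by module_ring.
    exact (eq_ind _ (is_series _) (HN v) _ E). }
  exists N. split; [split|split].
  - intros u v. apply (is_series_unique_vec (fun n => Nat.iter n P (plus u v)));
      [apply HN|].
    eapply is_series_ext; [|apply is_series_plus; apply HN].
    intros n. symmetry. apply (ll_iter _ _ n HP).
  - intros k u. apply (is_series_unique_vec (fun n => Nat.iter n P (scal k u)));
      [apply HN|].
    eapply is_series_ext; [|apply is_series_scal, HN].
    intros n. symmetry. apply (ll_iter _ _ n HP).
  - intros u. eapply norm_series_le; [apply HN|]. intros n.
    eapply Rle_trans.
    + apply (norm_sum_n_le _ (fun k => q ^ k * norm u)). intros k.
      apply norm_iter_le; [lra|exact HP].
    + pose proof (sum_n_mult_r (K := R_Ring) (norm u) (fun k => q ^ k) n) as E.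
      eapply Rle_trans; [right; exact E|].
      apply Rmult_le_compat_r; [apply norm_ge_0|].
      apply sum_n_le_series; [intros k; apply pow_le; lra|exact Hgeom].
  - intros v. assert (E : minus (N v) v = P (N v)).
    { eapply is_series_unique_vec; [apply Hshift|].
      apply (ll_series q P (fun n => Nat.iter n P v)); [lra|exact HP|apply HN]. }
    rewrite <- E. module_ring.
  - intros v. assert (E : minus (N v) v = N (P v)).
    { eapply is_series_unique_vec; [apply Hshift|].
      eapply is_series_ext; [|apply HN]. intros n. cbv beta.
      now rewrite <- Nat.iter_succ_r. }
    rewrite <- E. module_ring.
Qed.

(** Gives [resolvent] its meaning for [|l| > 1], where the inverse is [/ l] times the Neumann series
    of [/ l] times [T]. Both the directional limits and the regular expansions are exploited at such
    points. *)
Lemma contraction_resolvent (T : Y -> Y) (l : C) :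
  lipschitz_linear 1 T -> 1 < Cmod l -> is_resolvent T l (resolvent l T).
Proof.
  intros HT Hl. unfold resolvent. apply epsilon_spec.
  assert (Hl0 : l <> RtoC 0) by (intros ->; rewrite Cmod_0 in Hl; lra).
  assert (HP : lipschitz_linear (/ Cmod l)
    (fun v => scal (/ l : C_AbsRing)%C (T v))).
  { split.
    - intros u v. rewrite (ll_plus _ _ HT). module_ring.
    - intros k u. rewrite (ll_scal _ _ HT). module_ring.
    - intros u. eapply Rle_trans; [apply norm_scal|].
      change (Cmod (/ l) * norm (T u) <= / Cmod l * norm u).
      rewrite Cmod_inv by exact Hl0.
      apply Rmult_le_compat_l; [left; apply Rinv_0_lt_compat; lra|].
      pose proof (ll_norm _ _ HT u). lra. }
  assert (Hq : / Cmod l < 1) by (rewrite <- Rinv_1; apply Rinv_lt_contravar; lra).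
  assert (Hq0 : 0 < / Cmod l) by (apply Rinv_0_lt_compat; lra).
  destruct (neumann_series _ _ (conj (Rlt_le _ _ Hq0) Hq) HP) as [N [HN [H1 H2]]].
  exists (fun v => scal (/ l : C_AbsRing)%C (N v)). split; [split|split].
  - intros u v. rewrite (ll_plus _ _ HN). module_ring.
  - intros k u. pose proof (ll_scal _ _ HN k u) as E. simpl in E |- *.
    rewrite E. module_ring.
  - exists (Cmod (/ l) * / (1 - / Cmod l)). split.
    + apply Rmult_lt_0_compat; [|apply Rinv_0_lt_compat; lra].
      now rewrite Cmod_inv by exact Hl0.
    + intros u. eapply Rle_trans; [apply norm_scal|]. rewrite Rmult_assoc.
      apply Rmult_le_compat_l; [apply Cmod_ge_0|apply (ll_norm _ _ HN)].
  - intros v. pose proof (H1 v) as E. cbv beta in E.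
    rewrite (ll_scal _ _ HT).
    rewrite E at 1. module_eq; field; exact Hl0.
  - intros v. pose proof (H2 v) as E. cbv beta in E.
    rewrite (ll_scal _ _ HN) in E.
    rewrite (ll_minus _ _ _ _ HN), (ll_scal _ _ HN).
    rewrite E at 1. module_eq; field; exact Hl0.
Qed.
End Neumann.

(** * Summation by parts *)

Ltac C_components := apply injective_projections; simpl.

Definition cis (x : R) : C := (cos x, sin x).

Lemma cis_plus (x y : R) : cis (x + y) = (cis x * cis y)%C.
Proof. unfold cis. rewrite cos_plus, sin_plus. C_components; ring. Qed.

Lemma cis_0 : cis 0 = RtoC 1.
Proof. unfold cis. now rewrite cos_0, sin_0. Qed.

Lemma Cmod_cis (x : R) : Cmod (cis x) = 1.
Proof.
  unfold Cmod, cis; simpl fst; simpl snd.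
  replace (cos x ^ 2 + sin x ^ 2) with 1; [apply sqrt_1|].
  pose proof (sin2_cos2 x) as H. unfold Rsqr in H. simpl. lra.
Qed.

Section SymmetricOrbit.
Context {Y : NormedModule C_AbsRing}.

Lemma norm_scal_le (k : C) (B : R) (v : Y) :
  Cmod k <= B -> norm (scal (k : C_AbsRing) v) <= B * norm v.
Proof.
  intros H. eapply Rle_trans; [apply norm_scal|].
  apply Rmult_le_compat_r; [apply norm_ge_0|exact H].
Qed.

Lemma norm_scal_R (r : R) (v : Y) :
  norm (scal (RtoC r : C_AbsRing) v) <= Rabs r * norm v.
Proof. apply norm_scal_le. rewrite Cmod_R. lra. Qed.

Lemma norm_minus_le (u v : Y) : norm (minus u v) <= norm u + norm v.
Proof.
  unfold minus. eapply Rle_trans; [apply norm_triangle|]. rewrite norm_opp. lra.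
Qed.

(** The second difference moves from [b] to [c]. At the lower end [b 0] receives [c 0 - c 1], which
    [pred 0 = 0] encodes; at the upper end two boundary terms remain. *)
Lemma summation_by_parts2 (c : nat -> R) (b : nat -> Y) (N : nat) :
  plus (scal (RtoC (c O) : C_AbsRing) (minus (b O) (b 1%nat)))
    (sum_n (fun k => scal (RtoC (c (S k)) : C_AbsRing)
       (minus (minus (scal (RtoC 2 : C_AbsRing) (b (S k))) (b (S (S k)))) (b k))) N)
  = plus (sum_n (fun j => scal (RtoC (2 * c j - c (S j) - c (pred j)) : C_AbsRing) (b j)) (S N))
      (minus (scal (RtoC (c (S (S N))) : C_AbsRing) (b (S N)))
             (scal (RtoC (c (S N)) : C_AbsRing) (b (S (S N))))).
Proof.
  induction N as [|N IH].
  - rewrite sum_Sn, !sum_O. simpl Nat.pred. module_eq; C_components; ring.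
  - rewrite sum_Sn, plus_assoc, IH.
    rewrite (sum_Sn _ (S N)). set (Sg := sum_n _ (S N)). simpl Nat.pred.
    module_eq; C_components; ring.
Qed.

Lemma riemann_coef_tail_lim (h B : R) : 0 <= h ->
  is_lim_seq (fun N => (riemann_coef h (S (S N)) + riemann_coef h (S N)) * B) 0.
Proof.
  intros Hh.
  assert (H : is_lim_seq (fun N => riemann_coef h (S N)) 0).
  { apply (is_lim_seq_le_le (fun _ => 0) _ (fun N => 4 * / INR (S N))).
    - intros n. split; [now apply riemann_coef_pos|].
      eapply Rle_trans; [now apply riemann_coef_le_inv_sqr|].
      assert (1 <= INR (S n)) by (apply (le_INR 1); lia).
      set (x := INR (S n)) in *. clearbody x.
      apply Rmult_le_compat_l; [lra|]. apply Rinv_le_contravar; [lra|].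
      rewrite <- (pow_1 x) at 1. apply Rle_pow; [exact H|lia].
    - apply is_lim_seq_const.
    - replace (Finite 0) with (Rbar_mult 4 0) by (simpl; f_equal; ring).
      apply is_lim_seq_scal_l.
      apply (is_lim_seq_inv _ p_infty); [|discriminate].
      apply -> is_lim_seq_incr_1. apply is_lim_seq_INR. }
  replace (Finite 0) with (Rbar_mult (0 + 0) B) by (simpl; f_equal; ring).
  apply is_lim_seq_scal_r. apply is_lim_seq_plus'; [|exact H].
  apply -> (is_lim_seq_incr_1 (fun N => riemann_coef h (S N))). exact H.
Qed.

(** After summation by parts the indices [j >= 1] contribute 126 through the telescoping majorant,
    and [j = 0] contributes [h ^ 4 <= h ^ 3], hence 127. The last summand bounds the upper boundary
    terms and tends to 0 with [N]. *)
Lemma riemann_sum_diff2_le (h B : R) (b : nat -> Y) (N : nat) :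
  0 < h <= 1 -> (forall n, norm (b n) <= B) ->
  norm (plus (scal (RtoC (riemann_coef h 0) : C_AbsRing) (minus (b O) (b 1%nat)))
    (sum_n (fun k => scal (RtoC (riemann_coef h (S k)) : C_AbsRing)
       (minus (minus (scal (RtoC 2 : C_AbsRing) (b (S k))) (b (S (S k)))) (b k))) N))
  <= 127 * h ^ 3 * B
     + (riemann_coef h (S (S N)) + riemann_coef h (S N)) * B.
Proof.
  intros Hh Hb. rewrite summation_by_parts2.
  assert (HB : 0 <= B) by exact (Rle_trans _ _ _ (norm_ge_0 (b O)) (Hb O)).
  eapply Rle_trans; [apply norm_triangle|]. apply Rplus_le_compat.
  - change (norm (sum_n (fun j =>
      scal (RtoC (riemann_coef_diff2 h j) : C_AbsRing) (b j)) (S N))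
      <= 127 * h ^ 3 * B).
    assert (Hs : forall n, norm (sum_n (fun j =>
      scal (RtoC (riemann_coef_diff2 h (S j)) : C_AbsRing) (b (S j))) n)
      <= 126 * h ^ 3 * B).
    { intros n. eapply Rle_trans.
      - apply (norm_sum_n_le _ (fun k => telescope h k * (126 * h ^ 3 * B))).
        intros k. eapply Rle_trans; [apply norm_scal_R|].
        replace (telescope h k * (126 * h ^ 3 * B))
          with (126 * h ^ 3 * telescope h k * B) by ring.
        apply Rmult_le_compat; [apply Rabs_pos|apply norm_ge_0| |apply Hb].
        apply riemann_coef_diff2_le_telescope; lra.
      - eapply Rle_trans;
          [right; exact (sum_n_mult_r (K := R_Ring) _ (telescope h) n)|].
        unfold mult; simpl.
        rewrite <- (Rmult_1_l (126 * (h * (h * (h * 1))) * B)) at 2.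
        apply Rmult_le_compat_r; [|apply telescope_sum_le; lra].
        apply Rmult_le_pos; [|exact HB]. apply Rmult_le_pos; [lra|].
        apply (pow_le h 3); lra. }
    unfold sum_n in *. rewrite sum_Sn_m by lia.
    rewrite <- (sum_n_m_S (fun j => scal (RtoC (riemann_coef_diff2 h j)) (b j))).
    eapply Rle_trans; [apply norm_triangle|].
    apply Rle_trans with (h ^ 3 * B + 126 * h ^ 3 * B); [|right; ring].
    apply Rplus_le_compat; [|apply Hs].
    eapply Rle_trans; [apply norm_scal_R|].
    apply Rmult_le_compat; [apply Rabs_pos|apply norm_ge_0| |apply Hb].
    eapply Rle_trans; [apply riemann_coef_diff2_0; lra|].
    replace (h ^ 4) with (h * h ^ 3) by ring.
    rewrite <- (Rmult_1_l (h ^ 3)) at 2.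
    apply Rmult_le_compat_r; [apply pow_le|]; lra.
  - eapply Rle_trans; [apply norm_minus_le|]. rewrite Rmult_plus_distr_r.
    apply Rplus_le_compat; (eapply Rle_trans; [apply norm_scal_R|]);
      rewrite Rabs_pos_eq by (apply riemann_coef_pos; lra);
      (apply Rmult_le_compat_l; [apply riemann_coef_pos; lra|apply Hb]).
Qed.

Lemma riemann_sum_le (h B : R) (a : nat -> Y) (N : nat) :
  0 < h -> (forall n, norm (a n) <= B) ->
  norm (sum_n (fun k => scal (RtoC (riemann_coef h (S k)) : C_AbsRing) (a k)) N)
  <= 9 * h * B.
Proof.
  intros Hh Ha.
  assert (HB : 0 <= B) by exact (Rle_trans _ _ _ (norm_ge_0 (a O)) (Ha O)).
  eapply Rle_trans.
  - apply (norm_sum_n_le _ (fun k => telescope h k * (9 * h * B))).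
    intros k. eapply Rle_trans; [apply norm_scal_R|].
    replace (telescope h k * (9 * h * B)) with (9 * h * telescope h k * B) by ring.
    apply Rmult_le_compat; [apply Rabs_pos|apply norm_ge_0| |apply Ha].
    rewrite Rabs_pos_eq by (apply riemann_coef_pos; lra).
    apply riemann_coef_le_telescope; lra.
  - eapply Rle_trans;
      [right; exact (sum_n_mult_r (K := R_Ring) _ (telescope h) N)|].
    unfold mult; simpl. rewrite <- (Rmult_1_l (9 * h * B)) at 2.
    apply Rmult_le_compat_r; [|apply telescope_sum_le; lra].
    apply Rmult_le_pos; lra.
Qed.
End SymmetricOrbit.

(** * Riemann's function of an orbit *)

Lemma Cmod_cis_minus (x y : R) : Cmod (cis x - cis y) <= Rabs (x - y).
Proof.
  assert (E : Cmod (cis x - cis y) = sqrt (2 - 2 * cos (x - y))).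
  { unfold Cmod, cis. f_equal. simpl. rewrite cos_minus.
    pose proof (sin2_cos2 x) as H1. pose proof (sin2_cos2 y) as H2.
    unfold Rsqr in *. lra. }
  assert (Ec : cos (x - y) = cos (Rabs (x - y))).
  { unfold Rabs. destruct (Rcase_abs _); [now rewrite cos_neg|reflexivity]. }
  rewrite E, Ec. apply Rle_trans with (sqrt (Rabs (x - y) ^ 2)).
  - apply sqrt_le_1_alt, two_minus_two_cos, Rabs_pos.
  - right. apply sqrt_pow2, Rabs_pos.
Qed.

Lemma ex_series_inv_sqr : ex_series (fun k => / INR (S k) ^ 2).
Proof.
  assert (Hpos : forall k, 0 < INR (S k)) by (intros k; apply lt_0_INR; lia).
  assert (Ht : forall k, / INR (S k) ^ 2 <= 9 * telescope 1 k).
  { intros k. pose proof (Hpos k) as Hk.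
    assert (1 <= INR (S k)) by (apply (le_INR 1); lia).
    replace (9 * telescope 1 k) with (9 * 1 * telescope 1 k) by ring.
    assert (0 < / INR (S k) ^ 2) by (apply Rinv_0_lt_compat, pow_lt, Hk).
    apply le_telescope; [lra| |unfold Rdiv; lra].
    rewrite pow1, <- Rinv_1. apply Rinv_le_contravar; [lra|].
    now apply pow_R1_Rle. }
  apply (ex_series_le (V := R_CompleteNormedModule) _
    (fun k => scal 9 (telescope 1 k))).
  - intros k. unfold norm; simpl. unfold abs; simpl.
    rewrite Rabs_pos_eq; [apply Ht|].
    left. apply Rinv_0_lt_compat, (pow_lt _ 2), Hpos.
  - apply (ex_series_scal (V := R_NormedModule)).
    destruct (ex_finite_lim_seq_incr (sum_n (telescope 1)) 1) as [l Hl].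
    + intros n. rewrite sum_Sn.
      change (sum_n (telescope 1) n <= sum_n (telescope 1) n + telescope 1 (S n)).
      assert (0 < / INR (S (S n)) ^ 2) by (apply Rinv_0_lt_compat, pow_lt, Hpos).
      pose proof (Ht (S n)). lra.
    + intros n. apply telescope_sum_le. lra.
    + exists l. exact Hl.
Qed.

Section RiemannFunction.
Context {Y : NormedModule C_AbsRing}.
Hypothesis Ycomplete : abs_complete Y.
Variables T Ti : Y -> Y.
Hypothesis HT : lipschitz_linear 1 T.
Hypothesis HTi : lipschitz_linear 1 Ti.
Hypothesis TTi : forall v, T (Ti v) = v.
Hypothesis TiT : forall v, Ti (T v) = v.

(** The terms of index [n] and [-n] together, [U^n v + U^-n v] with [U = e^(-it) T]. At [n = 0] this
    is [2 v], twice the term of the series, so frequency zero is always treated apart. *)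
Definition symorb (t : R) (n : nat) (v : Y) : Y :=
  plus (scal (cis (- (INR n * t)) : C_AbsRing) (Nat.iter n T v))
       (scal (cis (INR n * t) : C_AbsRing) (Nat.iter n Ti v)).

Lemma norm_iter_contraction (P : Y -> Y) (n : nat) (v : Y) :
  lipschitz_linear 1 P -> norm (Nat.iter n P v) <= norm v.
Proof.
  intros HP. pose proof (norm_iter_le 1 P n v Rle_0_1 HP) as H.
  rewrite pow1 in H. lra.
Qed.

Lemma norm_symorb (t : R) (n : nat) (v : Y) :
  norm (symorb t n v) <= 2 * norm v.
Proof.
  eapply Rle_trans; [apply norm_triangle|].
  pose proof (norm_iter_contraction T n v HT).
  pose proof (norm_iter_contraction Ti n v HTi).
  pose proof (norm_scal_le (cis (- (INR n * t))) 1 (Nat.iter n T v)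
    (Req_le _ _ (Cmod_cis _))).
  pose proof (norm_scal_le (cis (INR n * t)) 1 (Nat.iter n Ti v)
    (Req_le _ _ (Cmod_cis _))).
  lra.
Qed.

Lemma norm_symorb_minus (t t' : R) (n : nat) (v : Y) :
  norm (minus (symorb t' n v) (symorb t n v))
  <= 2 * (INR n * Rabs (t' - t)) * norm v.
Proof.
  unfold symorb. set (a := Nat.iter n T v). set (b := Nat.iter n Ti v).
  replace (minus _ _) with
    (plus (scal (cis (- (INR n * t')) - cis (- (INR n * t)) : C_AbsRing)%C a)
          (scal (cis (INR n * t') - cis (INR n * t) : C_AbsRing)%C b))
    by module_ring.
  eapply Rle_trans; [apply norm_triangle|].
  assert (Ha : norm a <= norm v) by now apply norm_iter_contraction.
  assert (Hb : norm b <= norm v) by now apply norm_iter_contraction.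
  assert (E1 : Rabs (- (INR n * t') - - (INR n * t)) = INR n * Rabs (t' - t)).
  { replace (- (INR n * t') - - (INR n * t)) with (- (INR n * (t' - t))) by ring.
    rewrite Rabs_Ropp, Rabs_mult, (Rabs_pos_eq (INR n)); [ring|apply pos_INR]. }
  assert (E2 : Rabs (INR n * t' - INR n * t) = INR n * Rabs (t' - t)).
  { replace (INR n * t' - INR n * t) with (INR n * (t' - t)) by ring.
    rewrite Rabs_mult, (Rabs_pos_eq (INR n)); [ring|apply pos_INR]. }
  assert (Hd : 0 <= INR n * Rabs (t' - t)).
  { apply Rmult_le_pos; [apply pos_INR|apply Rabs_pos]. }
  pose proof (norm_scal_le _ _ a (Cmod_cis_minus (- (INR n * t')) (- (INR n * t)))) as H1.
  pose proof (norm_scal_le _ _ b (Cmod_cis_minus (INR n * t') (INR n * t))) as H2.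
  rewrite E1 in H1. rewrite E2 in H2.
  pose proof (Rmult_le_compat_l _ _ _ Hd Ha).
  pose proof (Rmult_le_compat_l _ _ _ Hd Hb). lra.
Qed.

Lemma symorb_0 (t : R) (v : Y) : symorb t 0 v = scal (RtoC 2 : C_AbsRing) v.
Proof.
  unfold symorb. simpl INR. simpl Nat.iter. rewrite Rmult_0_l, Ropp_0, cis_0.
  module_eq; C_components; ring.
Qed.

Lemma symorb_plus (t : R) (n : nat) (u v : Y) :
  symorb t n (plus u v) = plus (symorb t n u) (symorb t n v).
Proof.
  unfold symorb. destruct (ll_iter _ _ n HT) as [H1 _].
  destruct (ll_iter _ _ n HTi) as [H2 _]. rewrite H1, H2. module_ring.
Qed.

Lemma symorb_scal (t : R) (n : nat) (k : C) (v : Y) :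
  symorb t n (scal (k : C_AbsRing) v) = scal (k : C_AbsRing) (symorb t n v).
Proof.
  unfold symorb. destruct (ll_iter _ _ n HT) as [_ H1].
  destruct (ll_iter _ _ n HTi) as [_ H2]. rewrite H1, H2. module_ring.
Qed.

(** [(U + U^-1) w], the operator analogue of [2 cos]; it equals [symorb t 1 w]. *)
Definition two_cos_rotation (t : R) (w : Y) : Y :=
  plus (scal (cis (- t) : C_AbsRing) (T w)) (scal (cis t : C_AbsRing) (Ti w)).

(** The product formula for cosines, with powers of [U] in place of exponentials. It shows that
    [2 - U - U^-1] acts on the symmetric orbit as minus the second difference in [n]. *)
Lemma symorb_two_cos_rotation (t : R) (n : nat) (w : Y) :
  symorb t (S n) (two_cos_rotation t w)
  = plus (symorb t (S (S n)) w) (symorb t n w).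
Proof.
  unfold two_cos_rotation. rewrite symorb_plus, !symorb_scal. unfold symorb.
  assert (E1 : Nat.iter (S n) T (T w) = Nat.iter (S (S n)) T w)
    by (symmetry; apply Nat.iter_succ_r).
  assert (E2 : Nat.iter (S n) T (Ti w) = Nat.iter n T w)
    by (rewrite Nat.iter_succ_r, TTi; reflexivity).
  assert (E3 : Nat.iter (S n) Ti (Ti w) = Nat.iter (S (S n)) Ti w)
    by (symmetry; apply Nat.iter_succ_r).
  assert (E4 : Nat.iter (S n) Ti (T w) = Nat.iter n Ti w)
    by (rewrite Nat.iter_succ_r, TiT; reflexivity).
  rewrite E1, E2, E3, E4.
  set (a := Nat.iter n T w). set (b := Nat.iter n Ti w).
  set (c := Nat.iter (S (S n)) T w). set (d := Nat.iter (S (S n)) Ti w).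
  rewrite !S_INR.
  replace (- ((INR n + 1 + 1) * t)) with (- (INR n * t) + - t + - t) by ring.
  replace ((INR n + 1 + 1) * t) with (INR n * t + t + t) by ring.
  replace (- ((INR n + 1) * t)) with (- (INR n * t) + - t) by ring.
  replace ((INR n + 1) * t) with (INR n * t + t) by ring.
  rewrite !cis_plus.
  assert (E : (cis t * cis (- t))%C = RtoC 1).
  { rewrite <- cis_plus, Rplus_opp_r. apply cis_0. }
  set (p := cis (- t)) in *. set (q := cis t) in *.
  set (P := cis (- (INR n * t))). set (Q := cis (INR n * t)).
  clearbody p q P Q.
  module_eq; ring [E].
Qed.

(** The same product formula in the variable [t]: a second difference in [t] multiplies the term of
    index [n] by [2 cos (n h) - 2], which after division by [- n^2] is [riemann_coef h n]. *)
Lemma symorb_add (t h : R) (n : nat) (v : Y) :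
  plus (symorb (t + h) n v) (symorb (t - h) n v)
  = scal (RtoC (2 * cos (INR n * h)) : C_AbsRing) (symorb t n v).
Proof.
  unfold symorb.
  replace (- (INR n * (t + h))) with (- (INR n * t) + - (INR n * h)) by ring.
  replace (INR n * (t + h)) with (INR n * t + INR n * h) by ring.
  replace (- (INR n * (t - h))) with (- (INR n * t) + INR n * h) by ring.
  replace (INR n * (t - h)) with (INR n * t + - (INR n * h)) by ring.
  rewrite !cis_plus.
  assert (E : (cis (INR n * h) + cis (- (INR n * h)))%C
    = RtoC (2 * cos (INR n * h))).
  { unfold cis. rewrite cos_neg, sin_neg. C_components; ring. }
  rewrite <- E. module_ring.
Qed.
Lemma ex_riemann_series (y : Y) (t : R) :
  exists l, is_series (fun k =>
    scal (RtoC (/ INR (S k) ^ 2) : C_AbsRing) (symorb t (S k) y)) l.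
Proof.
  apply (Ycomplete _ (fun k => scal (2 * norm y) (/ INR (S k) ^ 2))).
  - intros k. eapply Rle_trans; [apply norm_scal_R|].
    assert (0 < / INR (S k) ^ 2).
    { apply Rinv_0_lt_compat, pow_lt, lt_0_INR; lia. }
    rewrite Rabs_pos_eq by lra. rewrite Rmult_comm.
    apply Rmult_le_compat_r; [lra|apply norm_symorb].
  - apply (ex_series_scal (V := R_NormedModule)), ex_series_inv_sqr.
Qed.

Definition riemann_sum (y : Y) (t : R) : Y :=
  proj1_sig (constructive_indefinite_description _ (ex_riemann_series y t)).

Lemma riemann_sum_series (y : Y) (t : R) :
  is_series (fun k =>
    scal (RtoC (/ INR (S k) ^ 2) : C_AbsRing) (symorb t (S k) y))
    (riemann_sum y t).
Proof.
  exact (proj2_sig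
    (constructive_indefinite_description _ (ex_riemann_series y t))).
Qed.

(* The formal second primitive of the trigonometric series with
   coefficients [T^n y], [n] ranging over the integers. *)
Definition riemann_fun (y : Y) (t : R) : Y :=
  minus (scal (RtoC (t ^ 2 / 2) : C_AbsRing) y) (riemann_sum y t).

Definition riemann_diff2 (y : Y) (t h : R) : Y :=
  minus (plus (riemann_fun y (t + h)) (riemann_fun y (t - h)))
        (scal (RtoC 2 : C_AbsRing) (riemann_fun y t)).

Lemma riemann_diff2_series (y : Y) (t h : R) :
  is_series (fun k =>
    scal (RtoC (riemann_coef h (S k)) : C_AbsRing) (symorb t (S k) y))
    (minus (riemann_diff2 y t h) (scal (RtoC (h ^ 2) : C_AbsRing) y)).
Proof.
  set (L := minus (scal (RtoC 2 : C_AbsRing) (riemann_sum y t))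
    (plus (riemann_sum y (t + h)) (riemann_sum y (t - h)))).
  assert (E : L = minus (riemann_diff2 y t h) (scal (RtoC (h ^ 2) : C_AbsRing) y)).
  { unfold L, riemann_diff2, riemann_fun. module_eq; C_components; field. }
  rewrite <- E. unfold L.
  eapply is_series_ext;
    [|apply is_series_minus;
      [apply is_series_scal, riemann_sum_series
      |apply is_series_plus; apply riemann_sum_series]].
  intros k. cbv beta. unfold riemann_coef.
  assert (Hk : INR (S k) <> 0) by (apply not_0_INR; lia).
  set (r := / INR (S k) ^ 2). set (a := symorb t (S k) y).
  assert (Ea : plus (symorb (t + h) (S k) y) (symorb (t - h) (S k) y)
    = scal (RtoC (2 * cos (INR (S k) * h)) : C_AbsRing) a) by apply symorb_add.
  apply eq_trans with (minus (scal (RtoC 2 : C_AbsRing) (scal (RtoC r : C_AbsRing) a))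
    (scal (RtoC r : C_AbsRing)
      (plus (symorb (t + h) (S k) y) (symorb (t - h) (S k) y)))).
  { module_ring. }
  rewrite Ea. unfold Rdiv. fold r. module_eq; C_components; ring.
Qed.

(* [y = 2 w - U w - U^-1 w + e] with [U = e^(-it) T]. *)
Lemma norm_riemann_diff2_le (y w e : Y) (t h : R) :
  y = plus (minus (scal (RtoC 2 : C_AbsRing) w) (two_cos_rotation t w)) e ->
  0 < h <= 1 ->
  norm (riemann_diff2 y t h) <= 254 * h ^ 3 * norm w + 19 * h * norm e.
Proof.
  intros Ey Hh.
  replace (riemann_diff2 y t h) with
    (plus (scal (RtoC (h ^ 2) : C_AbsRing) y)
      (minus (riemann_diff2 y t h) (scal (RtoC (h ^ 2) : C_AbsRing) y)))
    by module_ring.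
  apply (norm_series_le_lim _ _ _ _ (fun N =>
    (riemann_coef h (S (S N)) + riemann_coef h (S N)) * (2 * norm w))
    (riemann_diff2_series y t h)).
  2: { apply riemann_coef_tail_lim. lra. }
  intros N.
  (* Symmetric orbits cost a factor 2 in norm, so 254 = 2 * 127. Likewise 19 = 2 * 9 + 1, where the
     1 comes from the term [h ^ 2 * e] of frequency zero. *)
  set (b := fun n => symorb t n w).
  pose proof (riemann_sum_diff2_le h (2 * norm w) b N Hh
    (fun n => norm_symorb t n w)) as H1.
  pose proof (riemann_sum_le h (2 * norm e) (fun k => symorb t (S k) e) N
    ltac:(lra) (fun k => norm_symorb t (S k) e)) as H2.
  assert (H3 : norm (scal (RtoC (h ^ 2) : C_AbsRing) e) <= h * norm e).
  { eapply Rle_trans; [apply norm_scal_R|].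
    apply Rmult_le_compat_r; [apply norm_ge_0|].
    rewrite Rabs_pos_eq by apply pow2_ge_0.
    replace (h ^ 2) with (h * h) by ring. rewrite <- (Rmult_1_r h) at 3.
    apply Rmult_le_compat_l; lra. }
  set (A := plus _ _) in H1. set (B := sum_n _ N) in H2.
  assert (E : plus (scal (RtoC (h ^ 2) : C_AbsRing) y)
    (sum_n (fun k => scal (RtoC (riemann_coef h (S k)) : C_AbsRing)
      (symorb t (S k) y)) N)
    = plus A (plus (scal (RtoC (h ^ 2) : C_AbsRing) e) B)).
  { unfold A, B.
    rewrite (sum_n_ext (fun k => scal (RtoC (riemann_coef h (S k)) : C_AbsRing)
      (symorb t (S k) y)) (fun k => plus
        (scal (RtoC (riemann_coef h (S k)) : C_AbsRing)
          (minus (minus (scal (RtoC 2 : C_AbsRing) (b (S k))) (b (S (S k)))) (b k)))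
        (scal (RtoC (riemann_coef h (S k)) : C_AbsRing) (symorb t (S k) e)))).
    - rewrite sum_n_plus. unfold b at 4 5. rewrite symorb_0.
      assert (E1 : symorb t 1 w = two_cos_rotation t w).
      { unfold symorb, two_cos_rotation. simpl INR. simpl Nat.iter.
        now rewrite !Rmult_1_l. }
      rewrite E1, Ey. simpl riemann_coef. module_eq; C_components; ring.
    - intros k. rewrite Ey at 1. unfold minus at 1.
      rewrite <- scal_opp_one.
      rewrite !symorb_plus, (symorb_scal t (S k) (opp one)), symorb_scal.
      rewrite symorb_two_cos_rotation. fold (b (S k)) (b (S (S k))) (b k).
      module_eq; C_components; ring. }
  eapply Rle_trans; [right; exact (f_equal norm E)|].
  eapply Rle_trans; [apply norm_triangle|].
  eapply Rle_trans.
  { apply Rplus_le_compat; [exact H1|].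
    eapply Rle_trans; [apply norm_triangle|].
    apply Rplus_le_compat; [exact H3|exact H2]. }
  right. ring.
Qed.

(** The series part of [riemann_fun] has period [2 * PI]: all coefficients with [n >= 1] vanish, and
    only the quadratic term contributes. *)
Lemma riemann_diff2_full_turn (y : Y) (t : R) :
  riemann_diff2 y t (2 * PI) = scal (RtoC ((2 * PI) ^ 2) : C_AbsRing) y.
Proof.
  pose proof (riemann_diff2_series y t (2 * PI)) as H.
  assert (H0 : is_series (fun k => scal (RtoC (riemann_coef (2 * PI) (S k)) : C_AbsRing)
    (symorb t (S k) y)) zero).
  { apply is_series_norm. intros e He. exists O. intros n _.
    assert (E : sum_n (fun k => scal (RtoC (riemann_coef (2 * PI) (S k)) : C_AbsRing)
      (symorb t (S k) y)) n = zero).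
    { induction n as [|n IH]; rewrite ?sum_O, ?sum_Sn, ?IH; unfold riemann_coef;
        match goal with |- context [cos (INR ?m * _)] =>
          replace (INR m * (2 * PI)) with (0 + 2 * INR m * PI) by ring;
          rewrite cos_period, cos_0 end;
        unfold Rdiv; rewrite Rmult_1_r, Rminus_diag, Rmult_0_l; module_ring. }
    eapply Rle_lt_trans;
      [right; exact (f_equal (fun z => norm (minus z zero)) E)|].
    now rewrite norm_minus_self. }
  pose proof (is_series_unique_vec _ _ _ H H0) as E.
  apply eq_trans with (plus (minus (riemann_diff2 y t (2 * PI))
    (scal (RtoC ((2 * PI) ^ 2) : C_AbsRing) y))
    (scal (RtoC ((2 * PI) ^ 2) : C_AbsRing) y)); [module_ring|].
  rewrite E. module_ring.
Qed.

(** A local Hoelder estimate of exponent 1/2. With the distance measured as [h ^ 2], the increment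
    of the term of index [n] is at most [2 * norm y] times a quantity below both [h ^ 2] and
    [4 / n ^ 2], so [le_telescope] applies once more and gives 18 = 2 * 9. *)
Lemma norm_riemann_fun_minus_le (y : Y) (t t' h : R) :
  0 < h <= 1 -> Rabs (t' - t) <= h ^ 2 ->
  norm (minus (riemann_fun y t') (riemann_fun y t))
  <= (Rabs t + 19) * norm y * h.
Proof.
  intros Hh Hd. pose proof (norm_ge_0 y) as Hy.
  assert (Hh2 : h ^ 2 <= h).
  { rewrite <- (pow_1 h) at 2. replace (h ^ 2) with (h * h ^ 1) by ring.
    rewrite <- (Rmult_1_l (h ^ 1)) at 2. apply Rmult_le_compat_r; simpl; lra. }
  assert (H1 : norm (minus (riemann_sum y t') (riemann_sum y t)) <= 18 * h * norm y).
  { eapply norm_series_le;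
      [exact (is_series_minus _ _ _ _ (riemann_sum_series y t')
               (riemann_sum_series y t))|].
    intros n. eapply Rle_trans.
    - apply (norm_sum_n_le _ (fun k => telescope h k * (18 * h * norm y))).
      intros k. set (N := INR (S k)).
      assert (HN : 1 <= N) by (apply (le_INR 1); lia).
      assert (HN2 : 0 < / N ^ 2) by (apply Rinv_0_lt_compat, pow_lt; lra).
      pose proof (norm_symorb_minus t t' (S k) y) as B1.
      pose proof (norm_symorb t (S k) y) as B2.
      pose proof (norm_symorb t' (S k) y) as B3.
      pose proof (norm_minus_le (symorb t' (S k) y) (symorb t (S k) y)) as B4.
      fold N in B1.
      set (m := Rmin (N * Rabs (t' - t)) 2).
      assert (Hm : norm (minus (symorb t' (S k) y) (symorb t (S k) y))
        <= 2 * norm y * m).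
      { unfold m, Rmin. destruct (Rle_dec _ _); lra. }
      assert (Hm1 : m <= N * Rabs (t' - t)) by apply Rmin_l.
      assert (Hm2 : m <= 2) by apply Rmin_r.
      assert (Hv : m / N ^ 2 <= 9 * h * telescope h k).
      { apply le_telescope; [lra| |].
        - apply Rle_div_l; [apply pow_lt; lra|].
          eapply Rle_trans; [exact Hm1|]. rewrite Rmult_comm.
          apply Rmult_le_compat; [apply Rabs_pos|lra|exact Hd|].
          rewrite <- (pow_1 N) at 1. apply Rle_pow; [exact HN|lia].
        - apply Rmult_le_compat_r; [unfold N in HN2; lra|lra]. }
      replace (plus _ _) with (scal (RtoC (/ N ^ 2) : C_AbsRing)
        (minus (symorb t' (S k) y) (symorb t (S k) y))) by module_ring.
      eapply Rle_trans; [apply norm_scal_R|]. rewrite Rabs_pos_eq by lra.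
      apply Rle_trans with (/ N ^ 2 * (2 * norm y * m)).
      { apply Rmult_le_compat_l; lra. }
      replace (/ N ^ 2 * (2 * norm y * m)) with (2 * norm y * (m / N ^ 2))
        by (unfold Rdiv; ring).
      replace (telescope h k * (18 * h * norm y))
        with (2 * norm y * (9 * h * telescope h k)) by ring.
      apply Rmult_le_compat_l; [lra|exact Hv].
    - eapply Rle_trans;
        [right; exact (sum_n_mult_r (K := R_Ring) _ (telescope h) n)|].
      unfold mult; simpl. rewrite <- (Rmult_1_l (18 * h * norm y)) at 2.
      apply Rmult_le_compat_r; [|apply telescope_sum_le; lra].
      apply Rmult_le_pos; lra. }
  unfold riemann_fun.
  replace (minus _ _) with (minus
    (scal (RtoC ((t' - t) * (t' + t) / 2) : C_AbsRing) y)
    (minus (riemann_sum y t') (riemann_sum y t)))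
    by (module_eq; C_components; field).
  eapply Rle_trans; [apply norm_minus_le|].
  assert (H2 : norm (scal (RtoC ((t' - t) * (t' + t) / 2) : C_AbsRing) y)
    <= h * (Rabs t + 1) * norm y).
  { eapply Rle_trans; [apply norm_scal_R|].
    apply Rmult_le_compat_r; [exact Hy|].
    unfold Rdiv. rewrite Rmult_assoc, Rabs_mult.
    apply Rmult_le_compat; [apply Rabs_pos|apply Rabs_pos|lra|].
    replace ((t' + t) * / 2) with ((t' - t) * / 2 + t) by field.
    eapply Rle_trans; [apply Rabs_triang|].
    rewrite Rabs_mult, (Rabs_pos_eq (/ 2)) by lra. lra. }
  lra.
Qed.
End RiemannFunction.

(** * Uniqueness *)

Section Uniqueness.
Context {Y : NormedModule C_AbsRing}.
Hypothesis Ycomplete : abs_complete Y.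
Variables T Ti : Y -> Y.
Hypothesis HT : lipschitz_linear 1 T.
Hypothesis HTi : lipschitz_linear 1 Ti.
Hypothesis TTi : forall v, T (Ti v) = v.
Hypothesis TiT : forall v, Ti (T v) = v.

Lemma norm_scal_C (k : C) (v : Y) :
  norm (scal (k : C_AbsRing) v) = Cmod k * norm v.
Proof.
  apply Rle_antisym; [exact (norm_scal (k : C_AbsRing) v)|].
  destruct (Ceq_dec k (RtoC 0)) as [->|Hk].
  { rewrite Cmod_0, Rmult_0_l. apply norm_ge_0. }
  assert (E : v = scal (/ k : C_AbsRing)%C (scal (k : C_AbsRing) v))
    by (module_eq; field; exact Hk).
  rewrite E at 1.
  pose proof (norm_scal_le (/ k)%C (/ Cmod k) (scal (k : C_AbsRing) v)) as H.
  rewrite Cmod_inv in H by exact Hk. specialize (H (Rle_refl _)).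
  pose proof (proj1 (Cmod_gt_0 k) Hk) as Hk'.
  apply (Rmult_le_compat_l (Cmod k)) in H; [|lra].
  rewrite <- Rmult_assoc, Rinv_r, Rmult_1_l in H by lra. exact H.
Qed.

Lemma norm_minus_sym (u v : Y) : norm (minus u v) = norm (minus v u).
Proof. rewrite <- norm_opp. f_equal. module_ring. Qed.

Lemma norm_le_0_eq (u v : Y) : norm (minus u v) <= 0 -> u = v.
Proof.
  intros H. assert (E : minus u v = zero).
  { apply norm_eq_zero, Rle_antisym; [exact H|apply norm_ge_0]. }
  apply eq_trans with (plus (minus u v) v); [module_ring|].
  rewrite E. module_ring.
Qed.

(** * The range of the square of [xi - T] at singular and at regular points *)

Definition char_op (k : C) (v : Y) : Y := minus (scal (k : C_AbsRing) v) (T v).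

(** With [xi = cis t] and [U = e^(-it) T], one has [(xi - T)^2 = xi^2 (1 - U)^2 = - xi^2 U (2 - U -
    U^-1)], and [- xi^2 U v = - xi T v] is the chosen [w]. *)
Lemma char_op_sqr_two_cos (t : R) (y v e : Y) :
  y = plus (char_op (cis t) (char_op (cis t) v)) e ->
  let w := opp (scal (cis t : C_AbsRing) (T v)) in
  y = plus (minus (scal (RtoC 2 : C_AbsRing) w) (two_cos_rotation T Ti t w)) e.
Proof.
  intros -> w. unfold two_cos_rotation, w.
  replace (opp (scal (cis t : C_AbsRing) (T v)))
    with (scal (- cis t : C_AbsRing)%C (T v)) by module_ring.
  rewrite (ll_scal _ _ HT), (ll_scal _ _ HTi), TiT.
  unfold char_op. rewrite (ll_minus _ _ _ _ HT), (ll_scal _ _ HT).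
  assert (E : (cis t * cis (- t))%C = RtoC 1).
  { rewrite <- cis_plus, Rplus_opp_r. apply cis_0. }
  set (p := cis (- t)) in *. set (q := cis t) in *. clearbody p q.
  replace (RtoC 2) with (RtoC 1 + RtoC 1)%C by (C_components; ring).
  module_eq; ring [E].
Qed.

(** Since [T] is a contraction, [s - 1] times the resolvent at [s xi] is one too; this controls the
    second-order error in [singular_point_decomposition]. *)
Lemma char_op_norm (s : R) (xi : C) (v : Y) :
  Cmod xi = 1 -> 1 < s ->
  (s - 1) * norm v <= norm (char_op (RtoC s * xi) v).
Proof.
  intros Hxi Hs. unfold char_op.
  pose proof (norm_le_plus_minus (scal (RtoC s * xi : C_AbsRing)%C v) (T v)) as H.
  rewrite norm_minus_sym, norm_scal_C, Cmod_mult, Cmod_R, Hxi, Rabs_pos_eq in H by lra.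
  pose proof (ll_norm _ _ HT v). 
  apply Rplus_le_reg_l with (norm (T v)). eapply Rle_trans; [|exact H]. lra.
Qed.

(** With [d = s xi - xi], splitting [s xi - T] as [d + (xi - T)] gives [1 = d B + (xi - T) B].
    Applying this twice to [y] leaves [(xi - T)^2 B^2 y] and, with [e0 = d B y], the remainder
    [2 e0 - d B e0]. As [d B] is a contraction, the remainder is at most [3] times [e0] in norm. *)
Lemma singular_point_decomposition (B : Y -> Y) (s : R) (xi : C) (y : Y) :
  Cmod xi = 1 -> 1 < s -> is_resolvent T (RtoC s * xi)%C B ->
  exists v e, y = plus (char_op xi (char_op xi v)) e /\
    norm e <= 3 * norm (scal (RtoC s * xi - xi : C_AbsRing)%C (B y)).
Proof.
  intros Hxi Hs [HB [HB1 HB2]].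
  set (d := (RtoC s * xi - xi)%C).
  set (e := scal (d : C_AbsRing) (B y)).
  assert (H1 : forall u, u = plus (scal (d : C_AbsRing) (B u)) (char_op xi (B u))).
  { intros u. rewrite <- (HB1 u) at 1. unfold char_op, d. module_ring. }
  assert (He : B e = scal (d : C_AbsRing) (B (B y))) by apply (linear_scal _ HB).
  assert (Hc : forall k u, char_op xi (scal (k : C_AbsRing) u)
    = scal (k : C_AbsRing) (char_op xi u)).
  { intros k u. unfold char_op. rewrite (ll_scal _ _ HT). module_ring. }
  assert (Hp : forall u v, char_op xi (plus u v) = plus (char_op xi u) (char_op xi v)).
  { intros u v. unfold char_op. rewrite (ll_plus _ _ HT). module_ring. }
  exists (B (B y)), (minus (scal (RtoC 2 : C_AbsRing) e) (scal (d : C_AbsRing) (B e))).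
  split.
  - rewrite (H1 y) at 1. fold e. rewrite (H1 (B y)) at 1.
    rewrite Hp, <- He. pose proof (H1 e) as E.
    set (a := char_op xi (B e)) in *. clearbody a.
    assert (Ea : a = minus e (scal (d : C_AbsRing) (B e))).
    { rewrite E at 1. module_ring. }
    rewrite Ea. module_eq; C_components; ring.
  - eapply Rle_trans; [apply norm_minus_le|].
    rewrite !norm_scal_C, Cmod_R, Rabs_pos_eq by lra.
    change (2 * norm e + Cmod d * norm (B e) <= 3 * norm e).
    assert (Hd : Cmod d = s - 1).
    { unfold d. replace (RtoC s * xi - xi)%C with (RtoC (s - 1) * xi)%C
        by (C_components; ring).
      rewrite Cmod_mult, Cmod_R, Hxi, Rabs_pos_eq; lra. }
    pose proof (char_op_norm s xi (B e) Hxi Hs) as H.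
    unfold char_op in H. rewrite HB1 in H. rewrite Hd. lra.
Qed.

Lemma is_series_terms_bounded (a : nat -> Y) (l : Y) :
  is_series a l -> exists M, forall n, norm (a n) <= M.
Proof.
  intros Ha. destruct (filterlim_bounded (sum_n a)) as [M HM]; [now exists l|].
  exists (2 * M). intros [|n].
  - pose proof (HM O) as H. rewrite sum_O in H.
    pose proof (norm_ge_0 (a O)). lra.
  - pose proof (HM n). pose proof (HM (S n)) as H'. rewrite sum_Sn in H'.
    replace (a (S n)) with (minus (plus (sum_n a n) (a (S n))) (sum_n a n))
      by module_ring.
    eapply Rle_trans; [apply norm_minus_le|]. lra.
Qed.

Lemma Cmod_pow_n (z : C) (n : nat) :
  Cmod (pow_n (K := C_AbsRing) z n) = Cmod z ^ n.
Proof.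
  induction n as [|n IH]; [exact Cmod_1|].
  simpl. rewrite <- IH. apply Cmod_mult.
Qed.

(** Convergence at [z0] bounds [norm (a n) * Cmod z0 ^ n]. At half the radius the terms from order 2
    on are dominated by a geometric series of ratio at most 1/2, which doubles its leading term. *)
Lemma pseries_second_order (a : nat -> Y) (z0 : C) (l0 : Y) :
  z0 <> RtoC 0 -> is_pseries (K := C_AbsRing) a z0 l0 ->
  exists M, 0 <= M /\ forall z l, Cmod z <= Cmod z0 / 2 ->
    is_pseries (K := C_AbsRing) a z l ->
    norm (minus (plus (a O) (scal (z : C_AbsRing) (a 1%nat))) l)
    <= M * Cmod z ^ 2.
Proof.
  intros Hz0 H0. destruct (is_series_terms_bounded _ _ H0) as [M HM].
  assert (Hr : 0 < Cmod z0) by now apply Cmod_gt_0.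
  set (r := Cmod z0) in *.
  assert (Ha : forall n, norm (a n) <= M / r ^ n).
  { intros n. apply Rle_div_r; [now apply pow_lt|].
    specialize (HM n). cbv beta in HM.
    rewrite (norm_scal_C (pow_n (K := C_AbsRing) z0 n)), Cmod_pow_n in HM.
    fold r in HM. lra. }
  assert (HM0 : 0 <= M) by exact (Rle_trans _ _ _ (norm_ge_0 _) (HM O)).
  exists (2 * M / r ^ 2). split.
  { apply Rmult_le_pos; [lra|]. left. apply Rinv_0_lt_compat, pow_lt, Hr. }
  intros z l Hz Hl.
  set (q := Cmod z / r).
  assert (Hq : 0 <= q <= 1 / 2).
  { split; [apply Rmult_le_pos; [apply Cmod_ge_0|left; now apply Rinv_0_lt_compat]|].
    apply Rle_div_l; lra. }
  assert (Hgeom : is_series (fun n => q ^ n) (/ (1 - q))).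
  { apply is_series_geom. rewrite Rabs_pos_eq; lra. }
  pose proof (norm_series_tail_le
    (fun k => scal (pow_n (K := C_AbsRing) z k) (a k)) (fun n => M * q ^ n) l (M * / (1 - q)) 1%nat) as H.
  assert (E : sum_n (fun k => scal (pow_n (K := C_AbsRing) z k) (a k)) 1
    = plus (a O) (scal (z : C_AbsRing) (a 1%nat))).
  { rewrite sum_Sn, sum_O. simpl pow_n. rewrite mult_one_r.
    f_equal. apply (scal_one (K := C_AbsRing)). }
  eapply Rle_trans; [right; exact (f_equal (fun u => norm (minus u l)) (eq_sym E))|].
  eapply Rle_trans; [apply H|].
  - intros k. rewrite (norm_scal_C (pow_n (K := C_AbsRing) z k)), Cmod_pow_n.
    unfold q, Rdiv. rewrite Rpow_mult_distr, pow_inv.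
    replace (M * (Cmod z ^ k * / r ^ k)) with (Cmod z ^ k * (M / r ^ k))
      by (unfold Rdiv; ring).
    apply Rmult_le_compat_l; [apply pow_le, Cmod_ge_0|apply Ha].
  - exact Hl.
  - apply (is_series_scal (V := R_NormedModule) M), Hgeom.
  - rewrite sum_Sn, sum_O. unfold plus; simpl.
    replace (2 * M / (r * (r * 1)) * (Cmod z * (Cmod z * 1)))
      with (2 * M * q ^ 2) by (unfold q; field; lra).
    replace (M * / (1 - q) - (M * 1 + M * (q * 1))) with (M * q ^ 2 * / (1 - q))
      by (field; lra).
    replace (2 * M * q ^ 2) with (M * q ^ 2 * 2) by ring.
    apply Rmult_le_compat_l; [apply Rmult_le_pos; [lra|apply pow2_ge_0]|].
    replace 2 with (/ (1 / 2)) by field. apply Rinv_le_contravar; lra.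
Qed.

Lemma le_0_of_linear_bound (x K d : R) :
  0 < d -> (forall s, 0 < s < d -> x <= K * s) -> x <= 0.
Proof.
  intros Hd H. apply le_epsilon. intros e He. rewrite Rplus_0_l.
  assert (Hk : 0 < e / (Rabs K + 1)).
  { apply Rdiv_lt_0_compat; [exact He|pose proof (Rabs_pos K); lra]. }
  destruct (exists_pos_below _ _ Hd Hk) as [s [H0 [H1 H2]]].
  apply Rlt_div_r in H2; [|pose proof (Rabs_pos K); lra].
  specialize (H s (conj H0 H1)).
  pose proof (Rmult_le_compat_r s _ _ (Rlt_le _ _ H0) (Rle_abs K)). lra.
Qed.

(* Comparing the first two orders of [(l - T) g(l) = y] at [l = xi]. *)
Lemma regular_point_factorization (xi : C) (y : Y) (a : nat -> Y) (g : C -> Y)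
  (r : R) :
  Cmod xi = 1 -> 0 < r ->
  (forall s, 0 < s < r ->
     char_op (xi + RtoC s * xi)%C (g (RtoC s * xi)%C) = y /\
     is_pseries (K := C_AbsRing) a (RtoC s * xi)%C (g (RtoC s * xi)%C)) ->
  y = char_op xi (char_op xi (opp (a 1%nat))).
Proof.
  intros Hxi Hr H.
  assert (Hmod : forall s, 0 < s -> Cmod (RtoC s * xi) = s).
  { intros s Hs. rewrite Cmod_mult, Cmod_R, Hxi, Rabs_pos_eq; lra. }
  assert (Hz0 : (RtoC (r / 2) * xi)%C <> RtoC 0).
  { intros E. pose proof (Hmod (r / 2) ltac:(lra)) as Hm.
    rewrite E, Cmod_0 in Hm. lra. }
  destruct (pseries_second_order a _ _ Hz0 (proj2 (H (r / 2) ltac:(lra))))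
    as [M [HM0 HM]].
  rewrite Hmod in HM by lra.
  (* [r / 4] is half the modulus of the reference point [r / 2 * xi], as the second-order estimate
     requires; the bound 1 gives [Cmod (xi + z) <= 2], so that [xi + z - T] has norm at most 3. *)
  set (d := Rmin (r / 4) 1).
  assert (Hd : 0 < d) by (apply Rmin_pos; lra).
  assert (Hd1 : d <= r / 4) by apply Rmin_l.
  assert (Hd2 : d <= 1) by apply Rmin_r.
  set (a0 := a O) in *. set (a1 := a 1%nat) in *.
  (* [c1] is the coefficient of [z] in [(xi + z - T) (a0 + z a1 + ...)], which is constantly [y].
     Order zero gives [y = (xi - T) a0]; then [c1 = 0] gives [a0 = - (xi - T) a1]. *)
  set (c1 := plus a0 (char_op xi a1)).
  assert (Hmain : forall s, 0 < s < d ->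
    norm (minus (minus y (char_op xi a0)) (scal (RtoC s * xi : C_AbsRing)%C c1))
    <= (norm a1 + 3 * M) * s ^ 2).
  { intros s Hs. destruct (H s ltac:(lra)) as [H1 H2].
    pose proof (HM (RtoC s * xi)%C _ ltac:(rewrite Hmod; lra) H2) as H3.
    rewrite Hmod in H3 by lra.
    set (z := (RtoC s * xi)%C) in *.
    assert (Hz : Cmod z = s) by (apply Hmod; lra).
    set (rho := minus (plus a0 (scal (z : C_AbsRing) a1)) (g z)) in *.
    assert (Eg : g z = minus (plus a0 (scal (z : C_AbsRing) a1)) rho)
      by (unfold rho; module_ring).
    rewrite <- H1, Eg.
    replace (minus _ _) with (minus (scal (z * z : C_AbsRing)%C a1)
      (char_op (xi + z) rho)).
    2: { unfold c1, char_op.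
      rewrite !(ll_minus _ _ _ _ HT), (ll_plus _ _ HT), (ll_scal _ _ HT).
      module_ring. }
    eapply Rle_trans; [apply norm_minus_le|].
    rewrite norm_scal_C, Cmod_mult, Hz.
    assert (Hrho : norm (char_op (xi + z) rho) <= 3 * norm rho).
    { eapply Rle_trans; [apply norm_minus_le|].
      pose proof (ll_norm _ _ HT rho).
      assert (Hxz : Cmod (xi + z) <= 2).
      { eapply Rle_trans; [apply Cmod_triangle|]. lra. }
      pose proof (norm_scal_le _ _ rho Hxz). lra. }
    replace ((norm a1 + 3 * M) * s ^ 2) with (s * s * norm a1 + 3 * (M * s ^ 2))
      by ring.
    lra. }
  pose proof (norm_ge_0 a1) as Ha1.
  assert (E0 : y = char_op xi a0).
  { apply norm_le_0_eq.
    apply le_0_of_linear_bound with (norm c1 + (norm a1 + 3 * M)) d; [exact Hd|].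
    intros s Hs. specialize (Hmain s Hs).
    pose proof (norm_le_plus_minus (minus y (char_op xi a0))
      (scal (RtoC s * xi : C_AbsRing)%C c1)) as B.
    rewrite (norm_minus_sym (scal (RtoC s * xi : C_AbsRing)%C c1)), norm_scal_C,
      Hmod in B by lra.
    assert (s ^ 2 <= s).
    { replace (s ^ 2) with (s * s) by ring. rewrite <- (Rmult_1_r s) at 3.
      apply Rmult_le_compat_l; lra. }
    assert ((norm a1 + 3 * M) * s ^ 2 <= (norm a1 + 3 * M) * s).
    { apply Rmult_le_compat_l; lra. }
    lra. }
  assert (E1 : a0 = opp (char_op xi a1)).
  { apply norm_le_0_eq.
    replace (minus a0 (opp (char_op xi a1))) with c1 by (unfold c1; module_ring).
    apply le_0_of_linear_bound with (norm a1 + 3 * M) d; [exact Hd|].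
    intros s Hs. specialize (Hmain s Hs).
    apply Rmult_le_reg_l with s; [lra|].
    replace (s * ((norm a1 + 3 * M) * s)) with ((norm a1 + 3 * M) * s ^ 2) by ring.
    eapply Rle_trans; [|exact Hmain].
    rewrite E0.
    replace (minus (minus (char_op xi a0) (char_op xi a0)) (scal (RtoC s * xi : C_AbsRing)%C c1))
      with (scal (- (RtoC s * xi) : C_AbsRing)%C c1) by module_ring.
    rewrite norm_scal_C, Cmod_opp, Hmod by lra. lra. }
  rewrite E0, E1. f_equal. unfold char_op.
  replace (opp a1) with (scal (- RtoC 1 : C_AbsRing)%C a1) by module_ring.
  rewrite (ll_scal _ _ HT). module_ring.
Qed.

Lemma continuity_pt_norm (W : R -> Y) (t K : R) :
  (forall t' h, 0 < h <= 1 -> Rabs (t' - t) <= h ^ 2 ->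
    norm (minus (W t') (W t)) <= K * h) ->
  continuity_pt (fun t => norm (W t)) t.
Proof.
  intros H eps Heps.
  assert (HK : 0 <= K).
  { specialize (H t 1 ltac:(lra)). rewrite norm_minus_self in H.
    rewrite Rminus_diag, Rabs_R0 in H. lra. }
  assert (He : 0 < eps / (K + 1)) by (apply Rdiv_lt_0_compat; lra).
  destruct (exists_pos_below _ _ Rlt_0_1 He) as [h [H0 [H1 H2]]].
  exists (h ^ 2). split; [now apply pow_lt|].
  intros t' [_ Ht']. simpl in Ht' |- *. unfold R_dist in *.
  specialize (H t' h ltac:(lra) ltac:(simpl; lra)).
  eapply Rle_lt_trans; [apply (norm_triangle_inv (W t') (W t))|].
  apply Rlt_div_r in H2; [|lra]. lra.
Qed.

(** * Riemann's function is affine on two periods *)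

Definition riemann_regular (y : Y) (t : R) : Prop :=
  exists w, y = minus (scal (RtoC 2 : C_AbsRing) w) (two_cos_rotation T Ti t w).

Definition riemann_smooth (y : Y) (t : R) : Prop :=
  forall eps, 0 < eps -> exists w e,
    y = plus (minus (scal (RtoC 2 : C_AbsRing) w) (two_cos_rotation T Ti t w)) e /\
    norm e < eps.

Lemma riemann_uniqueness (y : Y) (f : nat -> R) :
  (forall t, 0 < t < 4 * PI -> riemann_regular y t \/
     ((exists n, f n = t) /\ riemann_smooth y t)) ->
  y = zero.
Proof.
  intros Hy. pose proof PI_RGT_0 as Hpi.
  set (F := riemann_fun Ycomplete T Ti HT HTi y).
  set (D := riemann_diff2 Ycomplete T Ti HT HTi y).
  set (P := F 0).
  set (Q := scal (RtoC (/ (4 * PI)) : C_AbsRing) (minus (F (4 * PI)) (F 0))).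
  set (W := fun t => minus (F t) (plus P (scal (RtoC t : C_AbsRing) Q))).
  (* An affine function has zero second difference, so that of [W] is [D]. The triangle inequality
     bounds the second difference of the norm from below only, which is the side the maximum
     principle uses. *)
  assert (HW : forall t h, norm (W (t + h)) + norm (W (t - h)) - 2 * norm (W t)
    >= - norm (D t h)).
  { intros t h.
    assert (E : scal (RtoC 2 : C_AbsRing) (W t)
      = minus (plus (W (t + h)) (W (t - h))) (D t h)).
    { unfold W, D, riemann_diff2. fold F. module_eq; C_components; ring. }
    pose proof (norm_scal_C (RtoC 2) (W t)) as H2.
    rewrite Cmod_R, Rabs_pos_eq in H2 by lra. rewrite E in H2.
    assert (H3 : 2 * norm (W t)
      <= norm (plus (W (t + h)) (W (t - h))) + norm (D t h)).
    { rewrite <- H2. apply norm_minus_le. }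
    assert (H4 : norm (plus (W (t + h)) (W (t - h)))
      <= norm (W (t + h)) + norm (W (t - h))) by apply norm_triangle.
    lra. }
  assert (HD : forall t h w e,
    y = plus (minus (scal (RtoC 2 : C_AbsRing) w) (two_cos_rotation T Ti t w)) e ->
    0 < h <= 1 -> norm (D t h) <= 254 * h ^ 3 * norm w + 19 * h * norm e).
  { intros t h w e E Hh. exact (norm_riemann_diff2_le Ycomplete T Ti HT HTi TTi TiT y w e t h E Hh). }
  assert (H0 : forall t, 0 <= t <= 4 * PI -> norm (W t) <= 0).
  { apply (schwarz_maximum_principle (fun t => norm (W t)) 0 (4 * PI) f).
    - lra.
    - intros t Ht. apply continuity_pt_norm with ((Rabs t + 19) * norm y + norm Q).
      intros t' h Hh Hd.
      pose proof (norm_riemann_fun_minus_le Ycomplete T Ti HT HTi y t t' h Hh Hd) as B.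
      fold F in B.
      replace (minus (W t') (W t)) with
        (minus (minus (F t') (F t)) (scal (RtoC (t' - t) : C_AbsRing) Q))
        by (unfold W; module_eq; C_components; ring).
      eapply Rle_trans; [apply norm_minus_le|].
      pose proof (norm_scal_R (t' - t) Q) as B'.
      assert (Rabs (t' - t) * norm Q <= h * norm Q).
      { apply Rmult_le_compat_r; [apply norm_ge_0|].
        eapply Rle_trans; [exact Hd|].
        replace (h ^ 2) with (h * h) by ring. rewrite <- (Rmult_1_r h) at 3.
        apply Rmult_le_compat_l; lra. }
      lra.
    - replace (W 0) with (zero : Y); [rewrite norm_zero; lra|].
      unfold W, P. module_eq; C_components; ring.
    - replace (W (4 * PI)) with (zero : Y); [rewrite norm_zero; lra|].
      unfold W, P, Q. module_eq; C_components; field; lra.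
    - intros t Ht. destruct (Hy t Ht) as [[w Hw]|[Hf Hs]]; [left|right; split; [exact Hf|]].
      + intros eps Heps. pose proof (norm_ge_0 w) as Hw0.
        assert (Hd : 0 < eps / (254 * norm w + 1)) by (apply Rdiv_lt_0_compat; lra).
        exists (Rmin 1 (eps / (254 * norm w + 1))).
        split; [apply Rmin_pos; lra|]. intros h Hh.
        pose proof (Rmin_l 1 (eps / (254 * norm w + 1))).
        pose proof (Rmin_r 1 (eps / (254 * norm w + 1))).
        assert (Hh2 : h * (254 * norm w + 1) < eps) by (apply Rlt_div_r; lra).
        assert (B : norm (D t h) <= 254 * h ^ 3 * norm w + 19 * h * norm (zero : Y)).
        { apply HD; [|lra]. rewrite Hw at 1. module_ring. }
        rewrite norm_zero in B. specialize (HW t h).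
        assert (h ^ 2 * (h * (254 * norm w + 1)) <= h ^ 2 * eps).
        { apply Rmult_le_compat_l; [apply pow2_ge_0|lra]. }
        assert (0 <= h ^ 3) by (apply pow_le; lra).
        replace (254 * h ^ 3 * norm w) with
          (h ^ 2 * (h * (254 * norm w + 1)) - h ^ 3) in B by ring.
        lra.
      + intros eps Heps.
        (* [eps / 38] turns the term [19 * h * norm e] into at most [eps / 2 * h]. The vector [w]
           depends on [eps] but not on [h], so the cubic term is below the other half for small
           [h]. *)
        destruct (Hs (eps / 38)) as [w [e [E He]]]; [lra|].
        pose proof (norm_ge_0 w) as Hw0.
        assert (Hd : 0 < eps / 2 / (254 * norm w + 1)) by (apply Rdiv_lt_0_compat; lra).
        exists (Rmin 1 (eps / 2 / (254 * norm w + 1))).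
        split; [apply Rmin_pos; lra|]. intros h Hh.
        pose proof (Rmin_l 1 (eps / 2 / (254 * norm w + 1))).
        pose proof (Rmin_r 1 (eps / 2 / (254 * norm w + 1))).
        assert (Hh2 : h * (254 * norm w + 1) < eps / 2) by (apply Rlt_div_r; lra).
        pose proof (HD t h w e E ltac:(lra)) as B. specialize (HW t h).
        assert (h * norm e <= h * (eps / 38)) by (apply Rmult_le_compat_l; lra).
        assert (h * h * (h * (254 * norm w + 1)) <= h * 1 * (eps / 2)).
        { apply Rmult_le_compat; [apply Rmult_le_pos; lra| | |lra].
          - apply Rmult_le_pos; lra.
          - apply Rmult_le_compat_l; lra. }
        assert (0 <= h ^ 3) by (apply pow_le; lra).
        replace (254 * h ^ 3 * norm w) with
          (h * h * (h * (254 * norm w + 1)) - h ^ 3) in B by ring.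
        lra. }
  assert (EF : forall t, 0 <= t <= 4 * PI -> F t = plus P (scal (RtoC t : C_AbsRing) Q)).
  { intros t Ht. apply norm_le_0_eq, H0, Ht. }
  (* Centre and step [2 * PI] involve the arguments [0], [2 * PI] and [4 * PI] only, all in the
     interval where [F] is affine. *)
  pose proof (riemann_diff2_full_turn Ycomplete T Ti HT HTi y (2 * PI)) as E.
  unfold riemann_diff2 in E. fold F in E.
  rewrite !EF in E by lra.
  assert (Hn : RtoC ((2 * PI) ^ 2) <> RtoC 0).
  { intros Hc. apply RtoC_inj in Hc.
    assert (0 < (2 * PI) ^ 2) by (apply pow_lt; lra). lra. }
  apply eq_trans with (scal (/ RtoC ((2 * PI) ^ 2) : C_AbsRing)%C
    (scal (RtoC ((2 * PI) ^ 2) : C_AbsRing) y)).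
  { module_eq. field. exact Hn. }
  rewrite <- E.
  replace (2 * PI - 2 * PI) with 0 by ring.
  replace (2 * PI + 2 * PI) with (4 * PI) by ring.
  module_eq; C_components; ring.
Qed.
End Uniqueness.

(** * The shift on bounded sequences modulo null sequences *)

Lemma cis_inj (s t : R) : cis s = cis t -> Rabs (s - t) < 2 * PI -> s = t.
Proof.
  intros E Hst. injection E as Ec Es.
  assert (H : cos (s - t) = 1).
  { rewrite cos_minus, Ec, Es. pose proof (sin2_cos2 t) as H.
    unfold Rsqr in H. lra. }
  assert (Hs : sin ((s - t) / 2) = 0).
  { replace (s - t) with (2 * ((s - t) / 2)) in H by field.
    rewrite cos_2a_sin in H. apply Rsqr_0_uniq. unfold Rsqr. lra. }
  apply Rabs_lt_between in Hst.
  destruct (Rtotal_order (s - t) 0) as [Hlt|[Heq|Hgt]]; [|lra|].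
  - pose proof (sin_gt_0 (- ((s - t) / 2)) ltac:(lra) ltac:(lra)) as H'.
    rewrite sin_neg in H'. lra.
  - pose proof (sin_gt_0 ((s - t) / 2) ltac:(lra) ltac:(lra)). lra.
Qed.

(** A point of the circle has at most one angle in each of the two turns. Even indices enumerate the
    angles of the first turn, odd ones those of the second, and uniqueness identifies the value
    picked by [epsilon] with the given angle. *)
Lemma countable_angles (A : C -> Prop) :
  countable A ->
  exists g : nat -> R, forall t, 0 < t < 4 * PI -> A (cis t) -> exists n, g n = t.
Proof.
  intros [f Hf].
  set (Q := fun n t => cis t = f (Nat.div2 n) /\
    if Nat.even n then 0 <= t < 2 * PI else 2 * PI <= t < 4 * PI).
  exists (fun n => epsilon (inhabits 0) (Q n)). intros t Ht HA.
  destruct (Hf _ HA) as [k Hk].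
  assert (H : exists n, Q n t).
  { destruct (Rlt_le_dec t (2 * PI)) as [H|H].
    - exists (2 * k)%nat. unfold Q. rewrite Nat.div2_double, Nat.even_even.
      split; [now symmetry|lra].
    - exists (S (2 * k)). unfold Q.
      rewrite Nat.div2_succ_double, Nat.even_succ, Nat.odd_even.
      split; [now symmetry|lra]. }
  destruct H as [n Hn]. exists n.
  assert (H : Q n (epsilon (inhabits 0) (Q n))) by (apply epsilon_spec; now exists t).
  destruct H as [E1 B1], Hn as [E2 B2].
  apply cis_inj; [now rewrite E1, E2|].
  destruct (Nat.even n); apply Rabs_def1; lra.
Qed.

Lemma quot_map_lipschitz (V : NormedModule C_AbsRing) (W : closed_subspace V)
  (f : V -> V) :
  lipschitz_linear 1 f -> (forall w, W w -> W (f w)) ->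
  lipschitz_linear 1 (quot_map f : quot_NormedModule W -> quot_NormedModule W).
Proof.
  intros Hf HW.
  assert (Hq : forall v, quot_map f (quot_proj W v) = quot_proj W (f v)).
  { apply quot_map_proj; [|exact HW]. intros u v. now apply (ll_minus 1). }
  split.
  - intros u v. rewrite <- (quot_reprK u), <- (quot_reprK v).
    change (quot_map f (quot_plus (quot_proj W (quot_repr u)) (quot_proj W (quot_repr v)))
      = quot_plus (quot_map f (quot_proj W (quot_repr u)))
                  (quot_map f (quot_proj W (quot_repr v)))).
    now rewrite quot_proj_plus, !Hq, quot_proj_plus, (ll_plus _ _ Hf).
  - intros k u. rewrite <- (quot_reprK u).
    change (quot_map f (quot_scal (k : C_AbsRing) (quot_proj W (quot_repr u)))
      = quot_scal (k : C_AbsRing) (quot_map f (quot_proj W (quot_repr u)))).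
    now rewrite quot_proj_scal, !Hq, quot_proj_scal, (ll_scal _ _ Hf).
  - intros u. rewrite Rmult_1_l. apply (quot_norm_ge (a := u)). intros v <-.
    rewrite Hq. eapply Rle_trans; [apply quot_norm_le|].
    pose proof (ll_norm _ _ Hf v). lra.
Qed.

Section Shift.
Context {X : NormedModule C_AbsRing}.

(** A right inverse of the shift, and a left inverse up to the first term, so a two-sided inverse
    modulo null sequences. The filler [zero] keeps it linear and contractive. *)
Definition right_shift_seq (x : nat -> X) (n : nat) : X :=
  match n with O => zero | S k => x k end.

Lemma bounded_right_shift (x : linf X) : bounded_seq (right_shift_seq x).
Proof.
  exists (sup_norm x). intros [|n]; simpl.
  - rewrite norm_zero. exact (Rle_trans _ _ _ (norm_ge_0 (x O)) (sup_norm_ge x O)).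
  - apply sup_norm_ge.
Qed.

Definition right_shift (x : linf X) : linf X := Linf (bounded_right_shift x).

Lemma shift_lipschitz :
  lipschitz_linear 1 (@shift _ X : linf_NormedModule X -> linf_NormedModule X).
Proof.
  split; intros.
  - now apply linf_ext.
  - now apply linf_ext.
  - rewrite Rmult_1_l. apply (sup_norm_le (x := shift u)). intros n.
    exact (sup_norm_ge u (S n)).
Qed.

Lemma right_shift_lipschitz :
  lipschitz_linear 1 (right_shift : linf_NormedModule X -> linf_NormedModule X).
Proof.
  split; intros.
  - apply linf_ext. intros [|n]; simpl; [|reflexivity].
    symmetry. apply plus_zero_l.
  - apply linf_ext. intros [|n]; simpl; [|reflexivity].
    symmetry. exact (scal_zero_r (V := X) _).
  - rewrite Rmult_1_l. apply (sup_norm_le (x := right_shift u)).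
    intros [|n]; simpl.
    + rewrite norm_zero. exact (Rle_trans _ _ _ (norm_ge_0 (u O)) (sup_norm_ge u O)).
    + exact (sup_norm_ge u n).
Qed.

Lemma shift_c0 (x : linf X) : c0 X x -> c0 X (shift x).
Proof.
  intros H. apply is_c0_norm. intros e.
  destruct (proj1 (is_c0_norm x) H e) as [N HN].
  exists N. intros n Hn. apply HN. lia.
Qed.

Lemma right_shift_c0 (x : linf X) : c0 X x -> c0 X (right_shift x).
Proof.
  intros H. apply is_c0_norm. intros e.
  destruct (proj1 (is_c0_norm x) H e) as [N HN].
  exists (S N). intros [|n] Hn; [lia|]. apply HN. lia.
Qed.

Definition right_shift_bar : linf_mod_c0 X -> linf_mod_c0 X :=
  quot_map (W := c0 X) right_shift.

Lemma shift_bar_lipschitz : lipschitz_linear 1 (@shift_bar _ X).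
Proof. exact (quot_map_lipschitz _ (c0 X) _ shift_lipschitz shift_c0). Qed.

Lemma right_shift_bar_lipschitz : lipschitz_linear 1 right_shift_bar.
Proof.
  exact (quot_map_lipschitz _ (c0 X) _ right_shift_lipschitz right_shift_c0).
Qed.

Lemma right_shift_barE (x : linf X) :
  right_shift_bar (linf_bar x) = linf_bar (right_shift x).
Proof.
  apply (quot_map_proj (W := c0 X)); [|exact right_shift_c0].
  intros u v. now apply (ll_minus 1 _ _ _ right_shift_lipschitz).
Qed.

Lemma shift_right_shift_bar (v : linf_mod_c0 X) :
  shift_bar (right_shift_bar v) = v.
Proof.
  rewrite <- (quot_reprK v). fold (linf_bar (quot_repr v)).
  rewrite right_shift_barE, shift_barE. f_equal. now apply linf_ext.
Qed.

Lemma right_shift_shift_bar (v : linf_mod_c0 X) :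
  right_shift_bar (shift_bar v) = v.
Proof.
  rewrite <- (quot_reprK v). set (x := quot_repr v : linf X).
  fold (linf_bar x). rewrite shift_barE, right_shift_barE.
  (* The two sequences agree from index 1 on; index 0 has been overwritten by [zero]. *)
  apply (quot_proj_eq (c0 X)). apply is_c0_norm. intros e. exists 1%nat.
  intros [|n] Hn; [lia|].
  change (norm (minus (x (S n)) (x (S n))) < e).
  rewrite norm_minus_self. apply cond_pos.
Qed.
End Shift.

(** [open] on [C] refers to the balls of the product structure, [analytic_on] to discs of the
    modulus; this passes from the second to the first. *)
Lemma C_ball_Cmod (z w : C) (e : posreal) : Cmod (w - z) < e -> ball z e w.
Proof.
  intros H. pose proof (Rmax_Cmod (w - z)%C) as Hm.
  split.
  - change (Rabs (fst (w - z)%C) < e). eapply Rle_lt_trans; [apply Rmax_l|].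
    eapply Rle_lt_trans; [exact Hm|exact H].
  - change (Rabs (snd (w - z)%C) < e). eapply Rle_lt_trans; [apply Rmax_r|].
    eapply Rle_lt_trans; [exact Hm|exact H].
Qed.

(** * From spectrum and directional limits to the uniqueness argument *)

Theorem theorem2p8 (X : CompleteNormedModule C_AbsRing) (x : nat -> X)
  (hx : bounded_seq x)
  (hcount : countable (seq_spectrum (Linf hx)))
  (hlim : forall xi0 : C, seq_spectrum (Linf hx) xi0 ->
    is_dir_lim
      (fun l : C => scal (l - xi0)%C
         (resolvent l (@shift_bar C_AbsRing X) (linf_bar (Linf hx))))
      xi0 (zero : linf_mod_c0 X)) :
  filterlim x eventually (locally (zero : X)).
Proof.
  set (T := @shift_bar C_AbsRing X) in *.
  set (Ti := @right_shift_bar X).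
  set (y := linf_bar (Linf hx)) in *.
  assert (Yc : abs_complete (linf_mod_c0 X)).
  { apply quot_abs_complete, linf_abs_complete. }
  assert (HT : lipschitz_linear 1 T) by apply shift_bar_lipschitz.
  assert (HTi : lipschitz_linear 1 Ti) by apply right_shift_bar_lipschitz.
  assert (TTi : forall v, T (Ti v) = v) by apply shift_right_shift_bar.
  assert (TiT : forall v, Ti (T v) = v) by apply right_shift_shift_bar.
  destruct (countable_angles _ hcount) as [f Hf].
  assert (Hy : y = zero).
  { apply (riemann_uniqueness Yc T Ti HT HTi TTi TiT y f). intros t Ht.
    pose proof (Cmod_cis t) as Hxi.
    destruct (classic (seq_spectrum (Linf hx) (cis t))) as [Hs|Hs].
    - right. split; [now apply Hf|]. intros eps Heps.
      specialize (hlim _ Hs). unfold is_dir_lim in hlim. rewrite Hxi in hlim.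
      (* The decomposition triples the norm of [(l - xi) R(l) y], hence [eps / 3]. The directional
         limit is evaluated at the single point [(1 + d / 2) * cis t], outside the circle. *)
      assert (He : 0 < eps / 3) by lra.
      pose proof (proj1 (filterlim_locally_ball_norm _ _) hlim (mkposreal _ He)) as H.
      destruct H as [d Hd].
      assert (Hs1 : 1 < 1 + d / 2) by (pose proof (cond_pos d); lra).
      specialize (Hd (1 + d / 2)). unfold ball_norm in Hd. simpl pos in Hd.
      rewrite Rdiv_1_r in Hd.
      assert (Hball : ball 1 d (1 + d / 2)).
      { change (Rabs (1 + d / 2 - 1) < d). pose proof (cond_pos d).
        rewrite Rabs_pos_eq; lra. }
      specialize (Hd Hball Hs1).
      assert (HB : is_resolvent T (RtoC (1 + d / 2) * cis t)%C
        (resolvent (RtoC (1 + d / 2) * cis t)%C T)).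
      { apply contraction_resolvent; [exact Yc|exact HT|].
        rewrite Cmod_mult, Cmod_R, Hxi, Rabs_pos_eq; lra. }
      destruct (singular_point_decomposition T HT _ _ _ y Hxi Hs1 HB)
        as [v [e [E Hle]]].
      exists (opp (scal (cis t : C_AbsRing) (T v))), e. split.
      + now apply (char_op_sqr_two_cos T Ti HT HTi TiT).
      + rewrite norm_minus_zero in Hd. eapply Rle_lt_trans; [exact Hle|].
        apply (Rmult_lt_compat_l 3) in Hd; [|lra].
        eapply Rlt_le_trans; [exact Hd|]. lra.
    - left.
      assert (Hreg : exists (U : C -> Prop) (h : C -> linf_mod_c0 X),
        open U /\ U (cis t) /\ analytic_on U h /\
        forall l : C, U l -> Cmod l <> 1 -> h l = resolvent_orbit (Linf hx) l).
      { apply NNPP. intros Hn. apply Hs. now split. }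
      destruct Hreg as [U [h [HU [HUt [Hh Hg]]]]].
      destruct (Hh _ HUt) as [a [r Hr]].
      destruct (HU _ HUt) as [d Hd].
      assert (E : y = char_op T (cis t) (char_op T (cis t) (opp (a 1%nat)))).
      { apply (regular_point_factorization T HT (cis t) y a
          (fun z => h (cis t + z)%C) (Rmin r d) Hxi).
        - apply Rmin_pos; apply cond_pos.
        - intros s Hsr. pose proof (Rmin_l r d). pose proof (Rmin_r r d).
          assert (Hm : Cmod (RtoC s * cis t) = s).
          { rewrite Cmod_mult, Cmod_R, Hxi, Rabs_pos_eq; lra. }
          assert (Em : (cis t + RtoC s * cis t - cis t = RtoC s * cis t)%C) by ring.
          assert (Hm' : Cmod (cis t + RtoC s * cis t) = 1 + s).
          { replace (cis t + RtoC s * cis t)%C with (RtoC (1 + s) * cis t)%C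
              by (C_components; ring).
            rewrite Cmod_mult, Cmod_R, Hxi, Rabs_pos_eq; lra. }
          split.
          (* At [(1 + s) * cis t] the extension [h] coincides with the resolvent orbit, and
             [resolvent] is a genuine inverse there because the modulus exceeds 1. *)
          + rewrite Hg.
            * assert (HB : is_resolvent T (cis t + RtoC s * cis t)%C
                (resolvent (cis t + RtoC s * cis t)%C T)).
              { apply contraction_resolvent; [exact Yc|exact HT|]. lra. }
              apply HB.
            * apply Hd, C_ball_Cmod. rewrite Em. lra.
            * lra.
          + pose proof (Hr (cis t + RtoC s * cis t)%C) as H'.
            rewrite Em in H'. apply H'. lra. }
      exists (opp (scal (cis t : C_AbsRing) (T (opp (a 1%nat))))).
      rewrite <- (plus_zero_r (minus _ _)).
      apply (char_op_sqr_two_cos T Ti HT HTi TiT). rewrite plus_zero_r. exact E. }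
  (* The vanishing of the class [y] is read back as membership of the sequence in [c0], which is the
     claimed limit. *)
  assert (Hc : c0 X (minus (Linf hx) (zero : linf X))).
  { apply (proj1 (quot_proj_eq (c0 X) _ _)). exact Hy. }
  assert (E : minus (Linf hx) (zero : linf X) = Linf hx).
  { apply linf_ext. intros n. exact (minus_zero_r (x n)). }
  rewrite E in Hc. exact Hc.
Qed.
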